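(* Let $V(z)=\sum_{j=1}^{2d}v_jz^j$ with $v_{2d}>0$, and for $t\ge1$ let $V(z;t)=(1-t^{-1})z^2+V(t^{-1/2}z)$, with free energy $F_N(t)=-N^{-2}\ln Z_N(t)$, $Z_N(t)=\int_{\mathbb R^N}\prod_{j<k}(z_j-z_k)^2e^{-N\sum_jV(z_j;t)}dz$. Then for $t\ge1$ $$F_N(t)=F_N^{\mathrm{Gauss}}+\int_t^\infty\frac{t-\tau}{\tau^2}\Big\{\gamma_N^2(\tau)\big[\gamma_{N-1}^2(\tau)+\gamma_{N+1}^2(\tau)+\beta_N^2(\tau)+2\beta_N(\tau)\beta_{N-1}(\tau)+\beta_{N-1}^2(\tau)\big]-\frac12\Big\}d\tau,$$ where $\gamma_n(\tau),\beta_n(\tau)$ ($n=N-1,N,N+1$) are the recurrence coefficients for the weight $e^{-NV(z;\tau)}$, and $$F_N^{\mathrm{Gauss}}=-\frac1{N^2}\ln\Big(\frac{(2\pi)^{N/2}}{(2N)^{N^2/2}}\prod_{n=1}^Nn!\Big)$$ is the free energy of the Gaussian ensemble (the integral converges).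
   Context: Recurrence coefficients for a weight $e^{-NU(z)}$: with $P_n(z)=z^n+\dots$ monic orthogonal polynomials on $\mathbb R$ and $h_n=\int P_n^2e^{-NU}dz$, $zP_n=P_{n+1}+\beta_nP_n+\gamma_n^2P_{n-1}$, $\gamma_n=\sqrt{h_n/h_{n-1}}>0$. *)

(* Defs.v *)
From HB Require Import structures.
From mathcomp Require Import all_boot all_order all_algebra.
From mathcomp Require Import all_classical all_reals all_analysis.
Set Implicit Arguments. Unset Strict Implicit. Unset Printing Implicit Defensive.
Import Order.TTheory GRing.Theory Num.Theory.
Local Open Scope classical_set_scope.
Local Open Scope ring_scope.

Section OPdefs.
Variable R : realType.
Local Notation mu := (@lebesgue_measure R).

(* Iterated Lebesgue integral over R^n of a (nonnegative) function of the
   coordinates [:: z_1; ...; z_n]; by Tonelli this is the integral over R^n. *)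
Fixpoint iter_int (n : nat) (f : seq R -> \bar R) : \bar R :=
  match n with
  | 0 => f [::]
  | n'.+1 => (\int[mu]_x iter_int n' (fun s => f (x :: s)))%E
  end.

Definition Vt (V : {poly R}) (t z : R) : R :=
  (1 - t^-1) * z ^+ 2 + V.[(Num.sqrt t)^-1 * z].

Definition weight (N : nat) (V : {poly R}) (t z : R) : R :=
  expR (- (N%:R * Vt V t z)).

Definition ZN (N : nat) (V : {poly R}) (t : R) : R :=
  fine (iter_int N (fun s =>
    ((\prod_(j < N) \prod_(k < N | (j < k)%N) (s`_j - s`_k) ^+ 2)
      * expR (- (N%:R * \sum_(j < N) Vt V t s`_j)))%:E)).

Definition FN (N : nat) (V : {poly R}) (t : R) : R :=
  - (N%:R ^- 2) * ln (ZN N V t).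

Definition FGauss (N : nat) : R :=
  - (N%:R ^- 2) *
    ln (Num.sqrt (2 * pi) ^+ N / Num.sqrt (2 * N%:R) ^+ (N ^ 2)
        * \prod_(1 <= n < N.+1) (n`!)%:R).

Definition monic_OP (w : R -> R) (P : nat -> {poly R}) : Prop :=
  forall n, P n \is monic /\ size (P n) = n.+1 /\
    forall m, m <> n ->
      Rintegral mu setT (fun x => (P n).[x] * (P m).[x] * w x) = 0.

Definition hn (w : R -> R) (P : nat -> {poly R}) (n : nat) : R :=
  Rintegral mu setT (fun x => (P n).[x] ^+ 2 * w x).

(* gamma_n = sqrt(h_n / h_{n-1}) (gamma_0 := 0, P_{-1} := 0 convention) *)
Definition gam (w : R -> R) (P : nat -> {poly R}) (n : nat) : R :=
  if n is n'.+1 then Num.sqrt (hn w P n / hn w P n') else 0.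

Definition recurrence_beta (w : R -> R) (P : nat -> {poly R})
    (beta : nat -> R) : Prop :=
  forall n, 'X * P n = P n.+1 + beta n *: P n + (gam w P n) ^+ 2 *: P n.-1.

Definition integrand (N : nat) (V : {poly R}) (P : R -> nat -> {poly R})
    (beta : R -> nat -> R) (t tau : R) : R :=
  let w := weight N V tau in
  let g := gam w (P tau) in
  let b := beta tau in
  (t - tau) / tau ^+ 2 *
   (g N ^+ 2 * (g N.-1 ^+ 2 + g N.+1 ^+ 2 + b N ^+ 2 + 2 * b N * b N.-1
                + b N.-1 ^+ 2) - 2^-1).

End OPdefs.

(* Main.v *)
(* In the variable $u = z / \sqrt t$ the weight becomes
   $e^{-N (t - 1) u^2 - N V(u)}$, so $t$ only enters linearly in the exponent
   and the moments satisfy $M_k' = -N M_{k+2}$.  Hence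
   $Z_N(t) = t^{N^2/2} N! \prod_{n<N} h_n(t)$ with $(\ln h_n)' = -N (Q^2)_{nn}$,
   $Q$ being the Jacobi matrix, and the Toda equations make $\sum_{n<N}
   (Q^2)_{nn}$ telescope: its derivative is $-N$ times
   $\gamma_N^2 (\gamma_{N-1}^2 + \gamma_{N+1}^2 + (\beta_N + \beta_{N-1})^2)$.
   This computes $F_N''$, and the integrand of the theorem is
   $(\tau - t) F_N''(\tau)$, with primitive $(\tau - t) F_N' - F_N$.  As
   $\tau \to \infty$ the moments of $e^{-N V(z;\tau)}$ converge to those of
   $e^{-N z^2}$, hence so do the recurrence coefficients (to those of the Hermite
   polynomials); this gives $F_N \to F_N^{Gauss}$ and $\tau F_N' \to 0$. *)
Require Import Defs.
From HB Require Import structures.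
From mathcomp Require Import all_boot all_order all_algebra.
From mathcomp Require Import all_classical all_reals all_analysis.
From mathcomp Require Import measurable_realfun perm polyrcf ring lra.
Import Order.TTheory GRing.Theory Num.Theory.
Import numFieldNormedType.Exports.
Local Open Scope classical_set_scope.
Local Open Scope ring_scope.

(** The polynomials are given separately for each $\tau$, with no regularity in $\tau$:
    differentiability and convergence of [P], [b] and [gamma2] have to be extracted from the
    moments, by induction along the recurrence. This is why the algebra is done for an abstract
    moment functional; analysis enters mainly through facts on moments: positivity, the flow in $t$,
    continuity, the limit at infinity and the Gaussian recursion. Both variables are needed. The
    flow of the moments holds in $u$, but the $u$-moments tend to 0 as $t \to \infty$, so limits are
    taken in $z$. With $Q_z$ the Jacobi matrix in $z$, $t F_N'(t) = -\frac12 + N^{-1} \sum_{n<N}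
    (Q_z^2)_{nn}$, and the Hermite value of the sum is $N/2$; the boundary term therefore vanishes
    without any rate of convergence. Derivatives are available for $t > 1$, so continuity is proved
    independently in order to reach the endpoint $t = 1$. *)

(** * Moment functionals on polynomials *)

Section MomentFunctional.
Context {R : realFieldType}.
Implicit Types (M : nat -> R) (p q : {poly R}).

(** Stands for $\int q\,w$ when [M] lists the moments of $w$; as a formal functional it makes sense
    without any integrability. *)
Definition Lm M q : R := \sum_(i < size q) q`_i * M i.

Lemma LmE M q n : (size q <= n)%N -> Lm M q = \sum_(i < n) q`_i * M i.
Proof.
move=> qn; rewrite /Lm (big_ord_widen n (fun i => q`_i * M i) qn) big_mkcond /=.
by apply: eq_bigr => i _; case: ltnP => // h; rewrite nth_default ?mul0r.
Qed.

Lemma Lm_is_linear M : linear_for *%R (Lm M).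
Proof.
move=> a p q; pose n := maxn (size p) (size q).
have pn : (size p <= n)%N by rewrite leq_maxl.
have qn : (size q <= n)%N by rewrite leq_maxr.
have hn : (size (a *: p + q)%R <= n)%N.
  rewrite (leq_trans (size_polyD _ _))// geq_max qn andbT.
  by rewrite (leq_trans (size_scale_leq _ _)).
rewrite (LmE _ _ _ hn) (LmE _ _ _ pn) (LmE _ _ _ qn) mulr_sumr -big_split /=.
by apply: eq_bigr => i _; rewrite coefD coefZ; ring.
Qed.

HB.instance Definition _ M :=
  GRing.isLinear.Build R {poly R} R *%R (Lm M) (Lm_is_linear M).

Lemma LmZ M a q : Lm M (a *: q) = a * Lm M q.
Proof. exact: linearZ. Qed.

Lemma LmD M p q : Lm M (p + q) = Lm M p + Lm M q.
Proof. exact: linearD. Qed.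

Lemma LmXn M n : Lm M 'X^n = M n.
Proof.
rewrite (LmE _ _ n.+1) ?size_polyXn// (bigD1 ord_max)//= coefXn eqxx mul1r.
rewrite big1 ?addr0// => i; rewrite -val_eqE /= coefXn => /negPf ->.
by rewrite mul0r.
Qed.

(** Formal counterpart of $\int q(ru)\,w(ru)\,du = r^{-1}\int q\,w$: the rescaled sequence lists the
    moments of $w(ru)$, the extra factor $r^{-1}$ being the Jacobian. *)
Lemma Lm_comp M r q : r != 0 ->
  Lm (fun k => r^-1 ^+ k.+1 * M k) (q \Po (r *: 'X)) = r^-1 * Lm M q.
Proof.
move=> r0; have sz : size (q \Po (r *: 'X)) = size q.
  by rewrite size_comp_poly2 // size_scale// size_polyX.
rewrite (LmE _ _ (size q)) ?sz// /Lm mulr_sumr; apply: eq_bigr => i _.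
have -> : (q \Po (r *: 'X))`_i = r ^+ i * q`_i.
  rewrite coef_comp_poly (bigD1 i)//= exprZn coefZ coefXn eqxx mulr1.
  rewrite big1 ?addr0 ?(mulrC q`_i)// => j ji.
  by rewrite exprZn coefZ coefXn eq_sym val_eqE (negPf ji) !mulr0.
have rn : r ^+ i != 0 by rewrite expf_neq0.
by rewrite exprS exprVn; field; rewrite rn r0.
Qed.

End MomentFunctional.

(** * Orthogonal polynomials and their Jacobi matrix *)

Section OrthogonalPolynomials.
Context {R : realFieldType}.
Implicit Types (M : nat -> R) (P : nat -> {poly R}) (b : nat -> R).

Definition sqnorm M P n : R := Lm M (P n ^+ 2).

(* Squared off-diagonal Jacobi coefficients: [gamma2] is $\gamma_n^2$, with
   $\gamma_0 = 0$. *)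
Definition gamma2 M P n : R :=
  if n is n'.+1 then sqnorm M P n / sqnorm M P n' else 0.

Lemma gamma2_0 M P : gamma2 M P 0 = 0. Proof. by []. Qed.
Arguments gamma2 : simpl never.

(** At [n = 0] the term [P n.-1] is [P 0] rather than $P_{-1} = 0$; the value [gamma2 M P 0 = 0]
    removes it. *)
Definition isOP M P b : Prop :=
  [/\ forall n, P n \is monic /\ size (P n) = n.+1,
      forall n m, m <> n -> Lm M (P n * P m) = 0,
      forall n, 0 < sqnorm M P n &
      forall n, 'X * P n = P n.+1 + b n *: P n + gamma2 M P n *: P n.-1].

(* Diagonal entry [n] of the square of the Jacobi matrix. *)
Definition jacobi2_diag M P b n : R := gamma2 M P n.+1 + b n ^+ 2 + gamma2 M P n.

(* Sum of the squared entries $(i, j)$, $i < n \le j$, of the square of the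
   normalized Jacobi matrix;
   with [n := N], the bracket in the statement. *)
Definition jacobi2_offdiag M P b n : R :=
  gamma2 M P n * (gamma2 M P n.-1 + gamma2 M P n.+1 + (b n + b n.-1) ^+ 2).

Definition subleading P n : R := if n is n'.+1 then (P n)`_n' else 0.

Variables (M : nat -> R) (P : nat -> {poly R}) (b : nat -> R).
Hypothesis opP : isOP M P b.

Lemma isOP_monic n : P n \is monic. Proof. by case: opP => /(_ n)[]. Qed.
Lemma isOP_size n : size (P n) = n.+1. Proof. by case: opP => /(_ n)[]. Qed.
Lemma isOP_lead n : (P n)`_n = 1.
Proof. by have /monicP := isOP_monic n; rewrite lead_coefE isOP_size. Qed.
Lemma isOP_orth n m : m <> n -> Lm M (P n * P m) = 0.
Proof. by case: opP => _ + _ _; apply. Qed.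
Lemma isOP_hgt0 n : 0 < sqnorm M P n. Proof. by case: opP. Qed.
Lemma isOP_hneq0 n : sqnorm M P n != 0. Proof. by rewrite gt_eqF ?isOP_hgt0. Qed.
Lemma isOP_rec n : 'X * P n = P n.+1 + b n *: P n + gamma2 M P n *: P n.-1.
Proof. by case: opP. Qed.

Lemma isOP_P0 : P 0%N = 1.
Proof.
have /size_poly1P[c _ Pc] : size (P 0%N) == 1%N by rewrite isOP_size.
by have := isOP_lead 0%N; rewrite Pc coefC eqxx => ->.
Qed.

Lemma size_subZP n (q : {poly R}) :
  (size q <= n.+1)%N -> (size (q - q`_n *: P n)%R <= n)%N.
Proof.
move=> qn; apply/leq_sizeP => j; rewrite leq_eqVlt => /orP[/eqP<-|nj].
  by rewrite coefB coefZ isOP_lead mulr1 subrr.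
rewrite coefB coefZ [q`_j]nth_default ?(leq_trans qn)//.
by rewrite [_`_j]nth_default ?isOP_size// mulr0 subr0.
Qed.

Lemma isOP_orth_lt n (q : {poly R}) : (size q <= n)%N -> Lm M (P n * q) = 0.
Proof.
suff H m : (m <= n)%N -> forall q : {poly R}, (size q <= m)%N -> Lm M (P n * q) = 0.
  exact: H.
elim: m => [|m IHm] mn {}q qm.
  move: qm; rewrite leqn0 size_poly_eq0 => /eqP ->.
  by rewrite mulr0 linear0.
rewrite -[q](subrK (q`_m *: P m)) mulrDr -scalerAr LmD LmZ.
rewrite IHm ?(ltnW mn) ?size_subZP// isOP_orth ?mulr0 ?addr0//.
by move=> e; rewrite e ltnn in mn.
Qed.

Lemma isOP_top n (q : {poly R}) :
  (size q <= n.+1)%N -> Lm M (P n * q) = q`_n * sqnorm M P n.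
Proof.
move=> qn; rewrite -{1}[q](subrK (q`_n *: P n)) mulrDr -scalerAr LmD LmZ.
by rewrite isOP_orth_lt ?size_subZP// add0r -expr2.
Qed.

Lemma isOP_hS n : sqnorm M P n.+1 = gamma2 M P n.+1 * sqnorm M P n.
Proof. by rewrite /gamma2 divfK ?isOP_hneq0. Qed.

Lemma Lm_PP n m : Lm M (P n * P m) = (n == m)%:R * sqnorm M P n.
Proof.
case: eqVneq => [->|/eqP nm]; first by rewrite mul1r -expr2.
by rewrite mul0r isOP_orth// => e; apply: nm.
Qed.

Let near_neq n : ((n.+1 == n) = false) * ((n.+2 == n) = false) *
  ((n.+3 == n) = false) * ((n == n.+1) = false) * ((n == n.+2) = false).
Proof. by do !split; apply/eqP; elim: n => // n IH [/IH]. Qed.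

(** Expresses [b n] through moments and [P n] alone, which is how [b] is later shown to be
    differentiable and to converge. *)
Lemma Lm_XP2 n : Lm M ('X * P n ^+ 2) = b n * sqnorm M P n.
Proof.
rewrite expr2 mulrA isOP_rec !mulrDl -!scalerAl !LmD !LmZ !Lm_PP eqxx.
case: n => [|n] /=; rewrite ?gamma2_0; last rewrite !eqSS !near_neq;
  by rewrite ?(mulr0n, mulr1n) !(mul0r, mul1r, mulr0, add0r, addr0).
Qed.

(** This is the squared norm of $xP_n$, whose three components in the recurrence are orthogonal. *)
Lemma Lm_X2P2 n : Lm M ('X^2 * P n ^+ 2) = jacobi2_diag M P b n * sqnorm M P n.
Proof.
rewrite -exprMn expr2 isOP_rec /jacobi2_diag.
have hS := isOP_hS n.
case: n hS => [|n] hS.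
  rewrite gamma2_0 scale0r !addr0; set rhs := RHS; rewrite !mulrDl !mulrDr.
  rewrite -!scalerAl -!scalerAr !LmD !LmZ !Lm_PP !near_neq !eqxx hS.
  by rewrite !(mulr0n, mulr1n) /rhs; ring.
have hS' := isOP_hS n.
set rhs := RHS; rewrite !mulrDl !mulrDr -!scalerAl -!scalerAr !LmD !LmZ !Lm_PP !eqxx.
rewrite [n.+1.-1]/= !eqSS !near_neq !(mulr0n, mulr1n).
by rewrite hS hS' /rhs hS'; ring.
Qed.

(** The expansions of $xP_{n+1}$ and $xP_n$ share only $P_{n+1}$ and $P_n$, contributing
    $b_{n+1}h_{n+1}$ and $b_n\gamma_{n+1}^2h_n = b_nh_{n+1}$. *)
Lemma Lm_X2PP n : Lm M ('X^2 * (P n.+1 * P n)) = (b n.+1 + b n) * sqnorm M P n.+1.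
Proof.
rewrite expr2 mulrACA (isOP_rec n.+1) (isOP_rec n) (isOP_hS n).
have hS := isOP_hS n.
case: n hS => [|n] hS.
  rewrite gamma2_0 scale0r addr0; set rhs := RHS; rewrite !mulrDl !mulrDr.
  rewrite -!scalerAl -!scalerAr !LmD !LmZ !Lm_PP !near_neq !eqxx hS.
  by rewrite !(mulr0n, mulr1n) /rhs; ring.
set rhs := RHS; rewrite !mulrDl !mulrDr -!scalerAl -!scalerAr !LmD !LmZ !Lm_PP !eqxx.
rewrite [n.+1.-1]/= !eqSS !near_neq !(mulr0n, mulr1n).
by rewrite hS /rhs; ring.
Qed.

(** Comparison of the coefficients of $x^n$ in the recurrence. *)
Lemma subleading_rec n : b n = subleading P n - subleading P n.+1.
Proof.
have /(congr1 (fun q : {poly R} => q`_n)) := isOP_rec n.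
rewrite !coefD !coefZ coefXM isOP_lead mulr1.
case: n => [|n] /=; first by rewrite gamma2_0 mul0r addr0 sub0r => e; lra.
rewrite [(P n)`_n.+1]nth_default ?isOP_size// mulr0 addr0 => ->; ring.
Qed.

End OrthogonalPolynomials.

(* The change of variable $z = r u$. *)
Section Rescaling.
Context {R : realFieldType}.
Variables (M : nat -> R) (P : nat -> {poly R}) (b : nat -> R) (r : R).
Hypotheses (opP : isOP M P b) (r0 : 0 < r).

Definition rescM k : R := r^-1 ^+ k.+1 * M k.
Definition rescP n : {poly R} := r^-1 ^+ n *: (P n \Po (r *: 'X)).

Let rn0 : r != 0. Proof. by rewrite gt_eqF. Qed.

Lemma Lm_rescPP n m :
  Lm rescM (rescP n * rescP m) = r^-1 ^+ (n + m).+1 * Lm M (P n * P m).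
Proof.
rewrite /rescP -scalerAl -scalerAr scalerA LmZ -comp_polyM Lm_comp//.
by rewrite mulrA -exprD -exprSr.
Qed.

Lemma sqnorm_resc n : sqnorm rescM rescP n = r^-1 ^+ (n.*2.+1) * sqnorm M P n.
Proof. by rewrite /sqnorm !expr2 Lm_rescPP addnn. Qed.

Lemma gamma2_resc n : gamma2 rescM rescP n = r ^- 2 * gamma2 M P n.
Proof.
case: n => [|n]; first by rewrite !gamma2_0 mulr0.
rewrite /gamma2 !sqnorm_resc doubleS !exprS; have := isOP_hneq0 _ _ _ opP n => h0.
have rn : r ^+ n.*2 != 0 by rewrite expf_neq0.
by rewrite !exprVn; field; rewrite h0 rn0 rn.
Qed.

Lemma isOP_resc : isOP rescM rescP (fun n => r^-1 * b n).
Proof.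
have sz n : size (rescP n) = n.+1.
  rewrite size_scale ?expf_neq0 ?invr_neq0// size_comp_poly2 ?(isOP_size _ _ _ opP)//.
  by rewrite size_scale// size_polyX.
split=> [n|n m mn|n|n].
- split=> //; apply/monicP; rewrite lead_coefE sz/= coefZ coef_comp_poly.
  rewrite (isOP_size _ _ _ opP) (bigD1 ord_max)//= (isOP_lead _ _ _ opP) mul1r.
  rewrite exprZn coefZ coefXn eqxx mulr1 big1 ?addr0 => [|i].
    by rewrite -exprMn mulVf// expr1n.
  by rewrite -val_eqE /= exprZn coefZ coefXn eq_sym => /negPf ->; rewrite !mulr0.
- by rewrite Lm_rescPP (isOP_orth _ _ _ opP)// mulr0.
- by rewrite sqnorm_resc mulr_gt0 ?exprn_gt0 ?invr_gt0// (isOP_hgt0 _ _ _ opP).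
- rewrite gamma2_resc /rescP.
  have := congr1 (fun q : {poly R} => r^-1 ^+ n.+1 *: (q \Po (r *: 'X)))
    (isOP_rec _ _ _ opP n).
  rewrite comp_polyM comp_polyX !comp_polyD !comp_polyZ.
  rewrite -scalerAl scalerA !scalerDr !scalerA -scalerAr => e.
  rewrite {1}exprSr divfK// in e; rewrite e; congr (_ + _ + _).
    by rewrite exprS; congr (_ *: _); ring.
  case: n {e} => [|n]; first by rewrite !gamma2_0 !(mulr0, mul0r).
  by rewrite !exprS; congr (_ *: _); field.
Qed.

End Rescaling.

Arguments gamma2 {R} M P n : simpl never.
Arguments sqnorm {R} M P n : simpl never.

(** * Differentiation of scalar and polynomial families *)

Section Derivation.
Context {R : realType}.
Implicit Types (f g : R -> R) (x : R).

Lemma derD x f g df dg : is_derive x 1 f df -> is_derive x 1 g dg ->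
  is_derive x 1 (fun t => f t + g t) (df + dg).
Proof. by move=> ? ?; exact: is_deriveD. Qed.

Lemma derM x f g df dg : is_derive x 1 f df -> is_derive x 1 g dg ->
  is_derive x 1 (fun t => f t * g t) (df * g x + f x * dg).
Proof.
move=> hf hg; apply: (is_derive_eq (is_deriveM hf hg)).
by rewrite addrC /GRing.scale /= mulrC.
Qed.

Lemma derC x (c : R) : is_derive x 1 (fun=> c) 0.
Proof. exact: is_derive_cst. Qed.

Lemma derZ x f df (c : R) : is_derive x 1 f df ->
  is_derive x 1 (fun t => c * f t) (c * df).
Proof. by move=> hf; exact: (is_deriveZ c). Qed.

Lemma derN x f df : is_derive x 1 f df -> is_derive x 1 (fun t => - f t) (- df).
Proof. by move=> hf; exact: is_deriveN. Qed.

Lemma derV x f df : f x != 0 -> is_derive x 1 f df ->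
  is_derive x 1 (fun t => (f t)^-1) (- df / f x ^+ 2).
Proof.
move=> fx hf; apply: (is_derive_eq (is_deriveV fx hf)).
by rewrite /GRing.scale /= mulrC mulrN mulNr.
Qed.

Lemma der_sum x n (f : nat -> R -> R) (df : nat -> R) :
  (forall i, is_derive x 1 (f i) (df i)) ->
  is_derive x 1 (fun t => \sum_(i < n) f i t) (\sum_(i < n) df i).
Proof.
move=> H; elim: n => [|n IHn].
  rewrite big_ord0 (_ : (fun _ => _) = fun=> 0); first exact: derC.
  by apply/funext => t; rewrite big_ord0.
rewrite big_ord_recr /= (_ : (fun _ => _) =
  fun t => \sum_(i < n) f i t + f n t); first exact: derD.
by apply/funext => t; rewrite big_ord_recr.
Qed.

Lemma der_uniq x f a b : is_derive x 1 f a -> is_derive x 1 f b -> a = b.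
Proof. by move=> [_ <-] [_ <-]. Qed.

Lemma der_ln x f df : 0 < f x -> is_derive x 1 f df ->
  is_derive x 1 (fun t => ln (f t)) (df / f x).
Proof.
move=> fx hf; have hln := is_derive1_ln fx.
apply: (is_derive_eq (is_derive1_comp hln hf)).
by rewrite mulrC.
Qed.

(** The degree bound, uniform in [t], turns [Lm] of the family into a sum of fixed length that can
    be differentiated termwise. *)
Definition dpoly (p : R -> {poly R}) x (q : {poly R}) : Prop :=
  (exists m, forall t, size (p t) <= m)%N /\
  forall k, is_derive x 1 (fun t => (p t)`_k) q`_k.

Lemma dpolyC x p : dpoly (fun=> p) x 0.
Proof. by split=> [|k]; [exists (size p)|rewrite coef0; exact: derC]. Qed.

Lemma dpolyD x p q dp dq : dpoly p x dp -> dpoly q x dq ->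
  dpoly (fun t => p t + q t) x (dp + dq).
Proof.
move=> [[m pm] hp] [[n qn] hq]; split=> [|k].
  exists (maxn m n) => t; rewrite (leq_trans (size_polyD _ _))// geq_max.
  by rewrite !leq_max pm qn orbT.
rewrite coefD (_ : (fun _ => _) = fun t => (p t)`_k + (q t)`_k).
  exact: derD.
by apply/funext => t; rewrite coefD.
Qed.

Lemma dpolyM x p q dp dq : dpoly p x dp -> dpoly q x dq ->
  dpoly (fun t => p t * q t) x (dp * q x + p x * dq).
Proof.
move=> [[m pm] hp] [[n qn] hq]; split=> [|k].
  exists (m + n)%N => t; rewrite (leq_trans (size_polyMleq _ _))//.
  by rewrite (leq_trans (leq_pred _))// leq_add.
rewrite coefD !coefM -big_split /=.
rewrite (_ : (fun _ => _) = fun t => \sum_(i < k.+1) (p t)`_i * (q t)`_(k - i)).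
  exact: (der_sum _ _ (fun i t => (p t)`_i * (q t)`_(k - i)) _
    (fun i => derM _ _ _ _ _ (hp i) (hq (k - i)%N))).
by apply/funext => t; rewrite coefM.
Qed.

Lemma dpolyZ x f df p dp : is_derive x 1 f df -> dpoly p x dp ->
  dpoly (fun t => f t *: p t) x (df *: p x + f x *: dp).
Proof.
move=> hf [[m pm] hp]; split=> [|k].
  by exists m => t; rewrite (leq_trans (size_scale_leq _ _)).
rewrite coefD !coefZ (_ : (fun _ => _) = fun t => f t * (p t)`_k).
  exact: derM.
by apply/funext => t; rewrite coefZ.
Qed.

Lemma dpoly_size x (p : R -> {poly R}) dp n :
  (forall t, size (p t) <= n)%N -> dpoly p x dp -> (size dp <= n)%N.
Proof.
move=> pn [_ hp]; apply/leq_sizeP => k nk; apply: der_uniq (hp k) _.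
rewrite (_ : (fun _ => _) = fun=> 0); first exact: derC.
by apply/funext => t; rewrite nth_default// (leq_trans (pn t)).
Qed.

End Derivation.

(* Along a flow [M' k = - kap * M (k + 2)] of the moments, i.e. for weights
   $e^{-\kappa t x^2} w(x)$, the recurrence coefficients satisfy Toda-type
   equations. *)
Section TodaFlow.
Context {R : realType}.
Variables (M : R -> nat -> R) (P : R -> nat -> {poly R}) (b : R -> nat -> R).
Variables (kap x : R).
Hypothesis opP : forall t, isOP (M t) (P t) (b t).
Hypothesis dM : forall k, is_derive x 1 (fun t => M t k) (- kap * M x k.+2).

Let h n t := sqnorm (M t) (P t) n.
Let g n t := gamma2 (M t) (P t) n.

(** Leibniz rule: the coefficients contribute [dp], while the flow shifts moment indices by two,
    which amounts to multiplication by ['X^2]. *)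
Lemma der_Lm p dp : dpoly p x dp ->
  is_derive x 1 (fun t => Lm (M t) (p t))
    (Lm (M x) dp - kap * Lm (M x) ('X^2 * p x)).
Proof.
move=> hp; have [[m pm] hc] := hp; have dpm := dpoly_size _ _ _ _ pm hp.
rewrite (LmE _ _ _ dpm) (_ : Lm _ ('X^2 * p x) = \sum_(i < m) (p x)`_i * M x i.+2).
  rewrite mulr_sumr -sumrB (_ : (fun _ => _) =
      fun t => \sum_(i < m) (p t)`_i * M t i).
    have H := der_sum _ _ (fun i t => (p t)`_i * M t i) _
      (fun i => derM _ _ _ _ _ (hc i) (dM i)).
    apply: (is_derive_eq (H m)).
    by apply: eq_bigr => i _; ring.
  by apply/funext => t; rewrite (LmE _ _ _ (pm t)).
rewrite (LmE _ _ m.+2).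
  rewrite !big_ord_recl /= !coefXnM /= !mul0r !add0r; apply: eq_bigr => i _.
  by rewrite coefXnM /= /bump /= !add1n subn2.
by rewrite (leq_trans (size_polyMleq _ _))// size_polyXn /= ltnS ltnS.
Qed.

(** The recurrence solved for $P_{n+1}$ propagates differentiability, since [b n] and [gamma2] are
    quotients of functionals of polynomials already treated. The degree drops because the leading
    coefficient is constantly 1. *)
Lemma isOP_dpoly n : exists2 dp, dpoly (P^~ n) x dp & (size dp <= n)%N.
Proof.
suff [dp hdp] : exists dp, dpoly (P^~ n) x dp.
  exists dp => //; apply/leq_sizeP => k; rewrite leq_eqVlt => /orP[/eqP <-|nk].
    apply: der_uniq (hdp.2 n) _; rewrite (_ : (fun _ => _) = fun=> 1).
      exact: derC.
    by apply/funext => t; rewrite (isOP_lead _ _ _ (opP t)).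
  have /leq_sizeP -> // : (size dp <= n.+1)%N.
  by apply: dpoly_size hdp => t; rewrite (isOP_size _ _ _ (opP t)).
(* A three-term recurrence requires two consecutive degrees in the induction. *)
suff : (exists dp, dpoly (P^~ n) x dp) /\ (exists dp, dpoly (P^~ n.+1) x dp).
  by case.
have dh m dp : dpoly (P^~ m) x dp -> exists dh, is_derive x 1 (h m) dh.
  move=> hp; eexists; rewrite (_ : h m = fun t => Lm (M t) (P t m * P t m)).
    exact: der_Lm (dpolyM _ _ _ _ _ hp hp).
  by apply/funext => t; rewrite -expr2.
have step m dp dg dq : dpoly (P^~ m) x dp ->
    is_derive x 1 (g m) dg -> dpoly (P^~ m.-1) x dq ->
    exists dr, dpoly (P^~ m.+1) x dr.
  move=> hp hg hq; have [dhm hdhm] := dh _ _ hp.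
  have [db hb] : exists db, is_derive x 1 (b^~ m) db.
    rewrite (_ : b^~ m = fun t => Lm (M t) ('X * (P t m * P t m)) * (h m t)^-1).
      eexists; apply: derM.
        exact: der_Lm (dpolyM _ _ _ _ _ (dpolyC _ 'X) (dpolyM _ _ _ _ _ hp hp)).
      exact: derV _ _ _ (isOP_hneq0 _ _ _ (opP x) m) hdhm.
    apply/funext => t; rewrite -expr2 (Lm_XP2 _ _ _ (opP t)) mulfK//.
    exact: isOP_hneq0 (opP t) _.
  rewrite (_ : P^~ m.+1 = fun t =>
      'X * P t m + ((-1) *: (b t m *: P t m) + (-1) *: (g m t *: P t m.-1))).
    eexists; apply: dpolyD (dpolyM _ _ _ _ _ (dpolyC _ 'X) hp) _.
    exact: dpolyD (dpolyZ _ _ _ _ _ (derC _ _) (dpolyZ _ _ _ _ _ hb hp))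
      (dpolyZ _ _ _ _ _ (derC _ _) (dpolyZ _ _ _ _ _ hg hq)).
  apply/funext => t; rewrite (isOP_rec _ _ _ (opP t)) !scaleN1r -/(g m t).
  by rewrite -!addrA addrC -addrA; ring.
elim: n => [|n [[dp hp] [dq hq]]].
  have hp0 : dpoly (P^~ 0%N) x 0.
    rewrite (_ : P^~ _ = fun=> 1); first exact: dpolyC.
    by apply/funext => t; rewrite (isOP_P0 _ _ _ (opP t)).
  have hg0 : is_derive x 1 (g 0%N) 0.
    rewrite (_ : g 0%N = fun=> 0); first exact: derC.
    by apply/funext => t; rewrite /g gamma2_0.
  by split; [exists 0|exact: (step 0%N _ _ _ hp0 hg0 hp0)].
split; first by exists dq.
have [dh1 hh1] := dh _ _ hq; have [dh0 hh0] := dh _ _ hp.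
apply: (step n.+1 _ _ _ hq _ hp).
exact: (derM _ _ _ _ _ hh1 (derV _ _ _ (isOP_hneq0 _ _ _ (opP x) n) hh0)).
Qed.

(** The derivative of [P n] has lower degree, hence is orthogonal to [P n]; only the flow of the
    moments contributes. *)
Lemma der_sqnorm n :
  is_derive x 1 (h n) (- kap * jacobi2_diag (M x) (P x) (b x) n * h n x).
Proof.
have [dp hp sdp] := isOP_dpoly n.
have := der_Lm _ _ (dpolyM _ _ _ _ _ hp hp).
rewrite (_ : (fun _ => _) = h n); last by apply/funext => t; rewrite -expr2.
rewrite LmD mulrC (isOP_orth_lt _ _ _ (opP x))// !add0r -expr2.
rewrite (Lm_X2P2 _ _ _ (opP x)) => H; apply: (is_derive_eq H).
by rewrite /h; ring.
Qed.

Lemma der_ln_sqnorm n :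
  is_derive x 1 (fun t => ln (h n t)) (- kap * jacobi2_diag (M x) (P x) (b x) n).
Proof.
apply: is_derive_eq; first exact: der_ln (isOP_hgt0 _ _ _ (opP x) n) (der_sqnorm n).
by rewrite mulfK// (isOP_hneq0 _ _ _ (opP x)).
Qed.

Lemma der_gamma2 n : is_derive x 1 (g n.+1)
  (- kap * g n.+1 x *
    (jacobi2_diag (M x) (P x) (b x) n.+1 - jacobi2_diag (M x) (P x) (b x) n)).
Proof.
have h0 := isOP_hneq0 _ _ _ (opP x) n.
apply: is_derive_eq; first exact: derM (der_sqnorm n.+1) (derV _ _ _ h0 (der_sqnorm n)).
by rewrite /g /gamma2 -/(h n x) -/(h n.+1 x); field.
Qed.

(** Obtained by differentiating the orthogonality of $P_{n+1}$ and $P_n$: in the terms with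
    differentiated polynomials only the top coefficient of $P_{n+1}'$ survives, multiplied by $h_n$,
    and it must balance the flow term given by [Lm_X2PP]. *)
Lemma der_subleading n : is_derive x 1 (fun t => subleading (P t) n)
  (kap * (g n x * (b x n + b x n.-1))).
Proof.
case: n => [|n]; first by rewrite /g gamma2_0 mul0r mulr0; exact: derC.
have [dp hp sdp] := isOP_dpoly n.+1; have [dq hq sdq] := isOP_dpoly n.
have := der_Lm _ _ (dpolyM _ _ _ _ _ hp hq).
rewrite (_ : (fun _ => _) = fun=> 0); last first.
  by apply/funext => t; rewrite (isOP_orth _ _ _ (opP t))//; exact: n_Sn.
move=> /der_uniq/(_ (derC _ _)).
rewrite LmD (isOP_orth_lt _ _ _ (opP x))// ?addr0; last exact: leqW.
rewrite mulrC (isOP_top _ _ _ (opP x))// (Lm_X2PP _ _ _ (opP x)).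
rewrite (isOP_hS _ _ _ (opP x)) -/(g _ _) mulrA mulrA -mulrBl.
move/eqP; rewrite mulf_eq0 (negPf (isOP_hneq0 _ _ _ (opP x) n)) orbF subr_eq0.
move=> /eqP e; apply: is_derive_eq; first exact: hp.2.
by rewrite e /=; ring.
Qed.

Lemma der_b n : is_derive x 1 (b^~ n)
  (kap * (g n x * (b x n + b x n.-1) - g n.+1 x * (b x n.+1 + b x n))).
Proof.
rewrite (_ : b^~ n = fun t => subleading (P t) n + - subleading (P t) n.+1).
  apply: is_derive_eq; first
    exact: derD (der_subleading n) (derN _ _ _ (der_subleading n.+1)).
  by rewrite /=; ring.
by apply/funext => t; rewrite (subleading_rec _ _ _ (opP t)).
Qed.

(** A discrete conservation law: [jacobi2_offdiag] is the flux between neighbouring sites, so that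
    sums over [n] telescope. *)
Lemma der_jacobi2_diag n : is_derive x 1 (fun t => jacobi2_diag (M t) (P t) (b t) n)
  (- kap * (jacobi2_offdiag (M x) (P x) (b x) n.+1 -
            jacobi2_offdiag (M x) (P x) (b x) n)).
Proof.
rewrite /jacobi2_diag (_ : (fun _ => _) = fun t => g n.+1 t + b t n * b t n + g n t);
  last by apply/funext => t; rewrite expr2.
have hb := der_b n.
case: n hb => [|n] hb.
  rewrite (_ : (fun t => _) = fun t => g 1%N t + b t 0%N * b t 0%N); last first.
    by apply/funext => t; rewrite /g gamma2_0 addr0.
  apply: is_derive_eq; first exact: derD (der_gamma2 0) (derM _ _ _ _ _ hb hb).
  by rewrite /jacobi2_offdiag /jacobi2_diag /g /= !gamma2_0; ring.
apply: is_derive_eq.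
  exact: derD (derD _ _ _ _ _ (der_gamma2 n.+1) (derM _ _ _ _ _ hb hb)) (der_gamma2 n).
by rewrite /jacobi2_offdiag /jacobi2_diag /g /=; ring.
Qed.

Lemma der_sum_jacobi2_diag n :
  is_derive x 1 (fun t => \sum_(i < n) jacobi2_diag (M t) (P t) (b t) i)
    (- kap * jacobi2_offdiag (M x) (P x) (b x) n).
Proof.
apply: is_derive_eq; first exact: der_sum (fun i => der_jacobi2_diag i).
rewrite -mulr_sumr; congr (_ * _); elim: n => [|n IHn].
  (* No flux enters at the boundary, because $\gamma_0 = 0$. *)
  by rewrite big_ord0 /jacobi2_offdiag gamma2_0 mul0r.
by rewrite big_ord_recr /= IHn addrC subrK.
Qed.

End TodaFlow.

(** * Continuous dependence on the moments, along an arbitrary filter (used at finite points and at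
    infinity) *)

Section Convergence.
Context {R : realType} {T : Type} (F : set_system T) {FF : ProperFilter F}.
Variables (M : T -> nat -> R) (P : T -> nat -> {poly R}) (b : T -> nat -> R).
Variables (M' : nat -> R) (P' : nat -> {poly R}) (b' : nat -> R).
Hypothesis opP : forall t, isOP (M t) (P t) (b t).
Hypothesis opP' : isOP M' P' b'.
Hypothesis cvg_mom : forall k, M t k @[t --> F] --> M' k.

Definition cvgp (p : T -> {poly R}) (q : {poly R}) : Prop :=
  (exists m, forall t, size (p t) <= m)%N /\
  forall k, (p t)`_k @[t --> F] --> q`_k.

Lemma cvgpC p : cvgp (fun=> p) p.
Proof. by split=> [|k]; [exists (size p)|exact: cvg_cst]. Qed.

Lemma cvgpD p q p' q' : cvgp p p' -> cvgp q q' ->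
  cvgp (fun t => p t + q t) (p' + q').
Proof.
move=> [[m pm] hp] [[n qn] hq]; split=> [|k].
  exists (maxn m n) => t; rewrite (leq_trans (size_polyD _ _))// geq_max.
  by rewrite !leq_max pm qn orbT.
by under eq_fun do rewrite coefD; rewrite coefD; exact: cvgD.
Qed.

Lemma cvg_sumn n (f : nat -> T -> R) (l : nat -> R) :
  (forall i, f i t @[t --> F] --> l i) ->
  \sum_(i < n) f i t @[t --> F] --> \sum_(i < n) l i.
Proof.
move=> H; elim: n => [|n IHn].
  by rewrite big_ord0; under eq_fun do rewrite big_ord0; exact: cvg_cst.
by rewrite big_ord_recr; under eq_fun do rewrite big_ord_recr/=; exact: cvgD.
Qed.

Lemma cvgpM p q p' q' : cvgp p p' -> cvgp q q' ->
  cvgp (fun t => p t * q t) (p' * q').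
Proof.
move=> [[m pm] hp] [[n qn] hq]; split=> [|k].
  exists (m + n)%N => t; rewrite (leq_trans (size_polyMleq _ _))//.
  by rewrite (leq_trans (leq_pred _))// leq_add.
rewrite coefM; under eq_fun do rewrite coefM.
apply: (cvg_sumn k.+1 (fun i t => (p t)`_i * (q t)`_(k - i))
  (fun i => p'`_i * q'`_(k - i))) => i.
by apply: cvgM; [exact: hp|exact: hq].
Qed.

Lemma cvgpZ f (l : R) p p' : f t @[t --> F] --> l -> cvgp p p' ->
  cvgp (fun t => f t *: p t) (l *: p').
Proof.
move=> hf [[m pm] hp]; split=> [|k].
  by exists m => t; rewrite (leq_trans (size_scale_leq _ _)).
by rewrite coefZ; under eq_fun do rewrite coefZ; exact: cvgM.
Qed.

Lemma cvgp_size (p : T -> {poly R}) p' n :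
  (forall t, size (p t) <= n)%N -> cvgp p p' -> (size p' <= n)%N.
Proof.
move=> pn [_ hp]; apply/leq_sizeP => k nk.
have h0 : (p t)`_k @[t --> F] --> (0 : R).
  rewrite (_ : (fun _ => _) = fun=> 0); first exact: cvg_cst.
  by apply/funext => t; rewrite nth_default// (leq_trans (pn t)).
by apply: (cvg_unique _ (hp k) h0); exact: norm_hausdorff.
Qed.

Lemma cvg_Lm p p' : cvgp p p' ->
  Lm (M t) (p t) @[t --> F] --> Lm M' p'.
Proof.
move=> hp; have [[m pm] hc] := hp; have pm' := cvgp_size _ _ _ pm hp.
rewrite (LmE _ _ _ pm'); under eq_fun do rewrite (LmE _ _ _ (pm _)).
apply: (cvg_sumn m (fun i t => (p t)`_i * M t i) (fun i => p'`_i * M' i)) => i.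
by apply: cvgM; [exact: hc|exact: cvg_mom].
Qed.

Lemma cvg_sqnorm_of n : cvgp (P^~ n) (P' n) ->
  sqnorm (M t) (P t) n @[t --> F] --> sqnorm M' P' n.
Proof.
move=> hp; rewrite /sqnorm expr2; under eq_fun do rewrite expr2.
exact: cvg_Lm (cvgpM _ _ _ _ hp hp).
Qed.

Lemma cvg_b_of n : cvgp (P^~ n) (P' n) -> b t n @[t --> F] --> b' n.
Proof.
move=> hp; have hb (M0 : nat -> R) P0 b0 : isOP M0 P0 b0 ->
    b0 n = Lm M0 ('X * (P0 n * P0 n)) / sqnorm M0 P0 n.
  by move=> op; rewrite -expr2 (Lm_XP2 _ _ _ op) mulfK// (isOP_hneq0 _ _ _ op).
rewrite (hb _ _ _ opP'); under eq_fun do rewrite (hb _ _ _ (opP _)).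
apply: cvgM; first exact: cvg_Lm (cvgpM _ _ _ _ (cvgpC 'X) (cvgpM _ _ _ _ hp hp)).
by apply: cvgV; [exact: isOP_hneq0 opP' n|exact: cvg_sqnorm_of].
Qed.

Lemma cvg_gamma2_of n : cvgp (P^~ n) (P' n) -> cvgp (P^~ n.-1) (P' n.-1) ->
  gamma2 (M t) (P t) n @[t --> F] --> gamma2 M' P' n.
Proof.
case: n => [|n] hp hq.
  by rewrite gamma2_0; under eq_fun do rewrite gamma2_0; exact: cvg_cst.
apply: cvgM; first exact: cvg_sqnorm_of.
by apply: cvgV; [exact: isOP_hneq0 opP' n|exact: cvg_sqnorm_of].
Qed.

(** Same induction along the recurrence as for differentiability; the divisions are harmless because
    the limiting functional has nonzero norms. *)
Lemma cvg_OP n : cvgp (P^~ n) (P' n).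
Proof.
have Psucc (M0 : nat -> R) P0 b0 : isOP M0 P0 b0 -> forall m, P0 m.+1 =
    'X * P0 m + ((-1) *: (b0 m *: P0 m) + (-1) *: (gamma2 M0 P0 m *: P0 m.-1)).
  by move=> op m; rewrite (isOP_rec _ _ _ op) !scaleN1r; ring.
have step m : cvgp (P^~ m) (P' m) -> cvgp (P^~ m.-1) (P' m.-1) ->
    cvgp (P^~ m.+1) (P' m.+1).
  move=> hp hq; rewrite (Psucc _ _ _ opP').
  rewrite (_ : P^~ m.+1 = fun t => 'X * P t m +
    ((-1) *: (b t m *: P t m) + (-1) *: (gamma2 (M t) (P t) m *: P t m.-1))).
    apply: cvgpD (cvgpM _ _ _ _ (cvgpC 'X) hp) _.
    apply: cvgpD; apply: cvgpZ (cvg_cst _) (cvgpZ _ _ _ _ _ _) => //.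
      exact: cvg_b_of.
    exact: cvg_gamma2_of.
  by apply/funext => t; rewrite (Psucc _ _ _ (opP t)).
suff : cvgp (P^~ n) (P' n) /\ cvgp (P^~ n.+1) (P' n.+1) by case.
have hp0 : cvgp (P^~ 0%N) (P' 0%N).
  rewrite (isOP_P0 _ _ _ opP') (_ : P^~ _ = fun=> 1); first exact: cvgpC.
  by apply/funext => t; rewrite (isOP_P0 _ _ _ (opP t)).
elim: n => [|n [hp hq]]; first by split=> //; exact: step.
by split=> //; exact: step.
Qed.

Lemma cvg_sqnorm n : sqnorm (M t) (P t) n @[t --> F] --> sqnorm M' P' n.
Proof. exact/cvg_sqnorm_of/cvg_OP. Qed.

Lemma cvg_b n : b t n @[t --> F] --> b' n.
Proof. exact/cvg_b_of/cvg_OP. Qed.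

Lemma cvg_gamma2 n : gamma2 (M t) (P t) n @[t --> F] --> gamma2 M' P' n.
Proof. by apply: cvg_gamma2_of; exact: cvg_OP. Qed.

Lemma cvg_jacobi2_diag n :
  jacobi2_diag (M t) (P t) (b t) n @[t --> F] --> jacobi2_diag M' P' b' n.
Proof.
apply: cvgD (cvg_gamma2 n); apply: cvgD (cvg_gamma2 n.+1) _.
by rewrite expr2; under eq_fun do rewrite expr2; apply: cvgM; exact: cvg_b.
Qed.

Lemma cvg_jacobi2_offdiag n :
  jacobi2_offdiag (M t) (P t) (b t) n @[t --> F] --> jacobi2_offdiag M' P' b' n.
Proof.
apply: cvgM (cvg_gamma2 n) _.
apply: cvgD; first by apply: cvgD; exact: cvg_gamma2.
rewrite expr2; under eq_fun do rewrite expr2.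
by apply: cvgM; (apply: cvgD; exact: cvg_b).
Qed.

End Convergence.

(** * The partition function as a product of norms *)

Section Heine.
Context {R : realType}.
Local Notation mu := (@lebesgue_measure R).

Lemma integrable_Rint_sum (I : Type) (s : seq I) (F : I -> R -> R) :
  (forall i, mu.-integrable setT (EFin \o F i)) ->
  mu.-integrable setT (EFin \o (fun x => \sum_(i <- s) F i x)) /\
  Rintegral mu setT (fun x => \sum_(i <- s) F i x) =
    \sum_(i <- s) Rintegral mu setT (F i).
Proof.
move=> intF; elim: s => [|i s [ints IHs]].
  rewrite big_nil (_ : (fun _ => _) = fun=> 0); last first.
    by apply/funext => x; rewrite big_nil.
  split; first exact: integrable0.
  by rewrite /Rintegral integral0.
rewrite big_cons (_ : (fun _ => _) = fun x => F i x + \sum_(j <- s) F j x).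
  split; last by rewrite RintegralD// IHs.
  by rewrite /comp; under eq_fun do rewrite EFinD; exact: (integrableD _ (intF i) ints).
by apply/funext => x; rewrite big_cons.
Qed.

(** Sums of products of one-variable functions are integrated one coordinate at a time, by linearity
    alone. *)
Lemma iter_int_sum_prod n (I : finType) (c : I -> R) (f : I -> 'I_n -> R -> R) :
  (forall i j, mu.-integrable setT (EFin \o f i j)) ->
  iter_int n (fun s => (\sum_i c i * \prod_(j < n) f i j s`_j)%:E) =
  (\sum_i c i * \prod_(j < n) Rintegral mu setT (f i j))%:E.
Proof.
elim: n c f => [|n IHn] c f intf /=.
  by congr (_%:E); apply: eq_bigr => i _; rewrite !big_ord0.
pose m i := \prod_(j < n) Rintegral mu setT (f i (lift ord0 j)).
pose G i (x : R) := c i * m i * f i ord0 x.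
have intG i : mu.-integrable setT (EFin \o G i).
  rewrite /comp /G; under eq_fun do rewrite EFinM.
  exact: (integrableZl measurableT _ (intf i ord0)).
transitivity (\int[mu]_x (\sum_i G i x)%:E)%E.
  apply: eq_integral => x _.
  (* The factor in the outer variable is absorbed into the coefficients, which are arbitrary in the
     induction hypothesis. *)
  transitivity (iter_int n (fun s => (\sum_i (c i * f i ord0 x) *
      \prod_(j < n) f i (lift ord0 j) s`_j)%:E)).
    congr (iter_int n); apply/funext => s; congr (_%:E); apply: eq_bigr => i _.
    by rewrite big_ord_recl mulrA.
  rewrite (IHn (fun i => c i * f i ord0 x) (fun i j => f i (lift ord0 j)))//.
  by congr (_%:E); apply: eq_bigr => i _; rewrite /G mulrAC.
have [ints eqs] := integrable_Rint_sum _ (index_enum I) _ intG.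
rewrite -[LHS]fineK; last exact: integrable_fin_num.
rewrite -/(Rintegral mu setT (fun x => \sum_i G i x)) eqs; congr (_%:E).
apply: eq_bigr => i _; rewrite RintegralZl// big_ord_recl /m.
by rewrite -mulrA; congr (_ * _); rewrite mulrC.
Qed.

(** The coefficient matrix of monic polynomials is triangular with unit diagonal, so replacing
    powers by [P i] leaves the Vandermonde determinant unchanged. *)
Lemma vandermonde_sqr n (P : nat -> {poly R}) (s : seq R) :
  (forall i, P i \is monic /\ size (P i) = i.+1) ->
  \prod_(j < n) \prod_(k < n | (j < k)%N) (s`_j - s`_k) ^+ 2 =
  (\det (\matrix_(j < n, i < n) (P i).[s`_j])) ^+ 2.
Proof.
move=> monP; pose A : 'M[R]_n := \matrix_(i, j) (P i)`_j.
pose a : 'rV[R]_n := \row_j s`_j.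
have detA : \det A = 1.
  rewrite det_trig; last first.
    apply/is_trig_mxP => i j ij; rewrite mxE nth_default//.
    by case: (monP i) => _ ->.
  apply: big1 => i _; rewrite mxE; have [/monicP + sz] := monP i.
  by rewrite lead_coefE sz.
rewrite -det_tr (_ : _^T = A *m Vandermonde n a).
  rewrite det_mulmx detA mul1r det_Vandermonde -prodrXl; apply: eq_bigr => j _.
  rewrite -prodrXl; apply: eq_bigr => k _.
  by rewrite !mxE -sqrrN opprB.
apply/matrixP => i j; rewrite !mxE.
rewrite (@horner_coef_wide _ n) ?(monP i).2//.
by apply: eq_bigr => k _; rewrite !mxE.
Qed.

(** Both determinants are expanded over permutations. Orthogonality leaves only equal pairs, where
    the signs square to 1 and each of the $n!$ permutations gives the same product of norms. *)
Lemma heine n (w : R -> R) (P : nat -> {poly R}) :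
  (forall i, P i \is monic /\ size (P i) = i.+1) ->
  (forall q : {poly R}, mu.-integrable setT (EFin \o (fun x => q.[x] * w x))) ->
  (forall i j, j <> i ->
     Rintegral mu setT (fun x => (P i).[x] * (P j).[x] * w x) = 0) ->
  iter_int n (fun s =>
    ((\prod_(j < n) \prod_(k < n | (j < k)%N) (s`_j - s`_k) ^+ 2)
      * \prod_(j < n) w s`_j)%:E) = (n`!%:R * \prod_(i < n) hn w P i)%:E.
Proof.
move=> monP intw orth.
pose f (k : 'S_n * 'S_n) (j : 'I_n) (x : R) :=
  (P (k.1 j)).[x] * (P (k.2 j)).[x] * w x.
pose c (k : 'S_n * 'S_n) : R := (-1) ^+ k.1 * (-1) ^+ k.2.
rewrite (_ : (fun s => _) = fun s => (\sum_k c k * \prod_(j < n) f k j s`_j)%:E);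
    last first.
  apply/funext => s; congr (_%:E); rewrite (vandermonde_sqr _ _ _ monP) /determinant.
  rewrite expr2 mulr_suml mulr_suml.
  rewrite (eq_bigr (fun s1 : 'S_n => \sum_(s2 : 'S_n)
      c (s1, s2) * \prod_(j < n) f (s1, s2) j s`_j)).
    by rewrite pair_bigA; apply: eq_bigr => -[].
  move=> s1 _; rewrite mulr_sumr mulr_suml; apply: eq_bigr => s2 _.
  rewrite mulrACA -[LHS]mulrA; congr (_ * _); rewrite -!big_split /=.
  by apply: eq_bigr => j _; rewrite !mxE.
rewrite iter_int_sum_prod; last first.
  move=> k j; rewrite /f (_ : (fun x => _) =
    fun x => (P (k.1 j) * P (k.2 j)).[x] * w x) //.
  by apply/funext => x; rewrite hornerM.
congr (_%:E).
rewrite -(pair_bigA _ (fun s1 s2 : 'S_n => c (s1, s2) *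
  \prod_(j < n) Rintegral mu setT (f (s1, s2) j))) /=.
transitivity (\sum_(s1 : 'S_n) \prod_(i < n) hn w P i).
  apply: eq_bigr => s1 _; rewrite (bigD1 s1)//= [X in _ + X]big1 ?addr0 => [|s2 s21].
    rewrite /c /= -expr2 sqrr_sign mul1r [RHS](reindex_inj (@perm_inj _ s1)) /=.
    apply: eq_bigr => j _; apply: eq_Rintegral => x _.
    by rewrite /f /= expr2.
  have [j sj] : exists j, s2 j != s1 j.
    apply/existsP; rewrite -negb_forall; apply: contra s21 => /forallP H.
    by apply/eqP/permP => j; apply/eqP.
  rewrite (bigD1 j)//= /f /= orth ?mul0r ?mulr0// => e.
  by move: sj; rewrite -val_eqE /= e eqxx.
by rewrite sumr_const card_Sn mulr_natl.
Qed.

End Heine.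

(** * Polynomial lower bounds and Gaussian integrals *)

Section GaussianDomination.
Context {R : realType}.
Local Notation mu := (@lebesgue_measure R).

Lemma even_poly_lower_bound (p : {poly R}) n :
  size p = n.*2.+1 -> 0 < lead_coef p -> exists C, forall x, C <= p.[x].
Proof.
move=> sp lp; have [B1 hB1] := poly_pinfty_gt_lc lp.
(* Since the degree is even, $p(-x)$ has the same leading coefficient; this handles the negative
   half-line. *)
have lq : 0 < lead_coef (p \Po -'X).
  rewrite lead_coef_comp ?size_polyN ?size_polyX// lead_coefN lead_coefX sp /=.
  by rewrite -mul2n exprM sqrrN expr1n expr1n mulr1.
have [B2 hB2] := poly_pinfty_gt_lc lq.
pose B := Num.max `|B1| `|B2|; have [C hC] := poly_disk_bound p B.
exists (- `|C|) => x; have [xB|xB] := leP `|x| B.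
  have /ler_normlP[+ _] := hC _ xB; have := ler_norm C; lra.
apply: (@le_trans _ _ 0); first by rewrite oppr_le0.
have : B1 <= B by rewrite le_max ler_norm.
have : B2 <= B by rewrite le_max ler_norm orbT.
move=> hb2 hb1; case: (lerP 0 x) => x0.
  apply/ltW/(lt_le_trans lp)/hB1; move: xB; rewrite ger0_norm//; lra.
apply/ltW/(lt_le_trans lq); have := hB2 (- x).
rewrite horner_comp !hornerE opprK; apply.
by move: xB; rewrite ltr0_norm//; lra.
Qed.

Lemma quadratic_lower_bound (V : {poly R}) d :
  (0 < d)%N -> size V = (2 * d).+1 -> 0 < lead_coef V ->
  (* The half keeps the leading coefficient of $V - cz^2$ positive when $d = 1$; the bound $c \le 1$
     is what makes the estimate of $V(z;t)$ uniform in $t$. *)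
  exists c C, [/\ 0 < c, c <= 1 & forall x, c * x ^+ 2 - C <= V.[x]].
Proof.
move=> d0 sV lV; pose c := Num.min 1 (lead_coef V / 2).
have c0 : 0 < c by rewrite lt_min ltr01 divr_gt0.
have cV : c <= lead_coef V / 2 by rewrite ge_min lexx orbT.
pose q := V - c *: 'X^2.
have q2d : lead_coef V / 2 <= q`_(2 * d).
  rewrite coefB coefZ coefXn; have -> : V`_(2 * d) = lead_coef V by rewrite lead_coefE sV.
  by case: eqP => _ /=; rewrite ?mulr1 ?mulr0; lra.
have q2d0 : 0 < q`_(2 * d) by apply: lt_le_trans q2d; rewrite divr_gt0.
have sq : size q = d.*2.+1.
  apply/eqP; rewrite -mul2n eqn_leq; apply/andP; split.
    rewrite (leq_trans (size_polyD _ _))// geq_max sV leqnn size_polyN.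
    by rewrite (leq_trans (size_scale_leq _ _))// size_polyXn ltnS leq_pmulr.
  rewrite ltnNge; apply/negP => /leq_sizeP/(_ (2 * d)%N (leqnn _)) e.
  by rewrite e ltxx in q2d0.
have lq : 0 < lead_coef q by rewrite lead_coefE sq /= -mul2n.
have [C hC] := even_poly_lower_bound _ _ sq lq.
exists c, (- C); split=> // [|x]; first by rewrite ge_min lexx.
by have := hC x; rewrite /q !hornerE; lra.
Qed.

Lemma gauss_normal_pdf (a x : R) : 0 < a ->
  expR (- (a * x ^+ 2)) =
  Num.sqrt (pi / a) * normal_pdf 0 (Num.sqrt (2 * a)^-1) x.
Proof.
move=> a0; have s2 : Num.sqrt (2 * a)^-1 ^+ 2 = (2 * a)^-1.
  by rewrite sqr_sqrtr// invr_ge0 mulr_ge0// ltW.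
have s0 : Num.sqrt (2 * a)^-1 != 0.
  by rewrite gt_eqF// sqrtr_gt0 invr_gt0 mulr_gt0.
rewrite /normal_pdf (negPf s0) /normal_peak /normal_fun s2.
have -> : (2 * a)^-1 * pi *+ 2 = pi / a by rewrite -mulr_natr; field; rewrite gt_eqF.
rewrite [RHS]mulrA divff ?gt_eqF ?sqrtr_gt0 ?divr_gt0 ?pi_gt0// mul1r subr0.
by congr (expR _); rewrite -mulr_natr; field; rewrite gt_eqF.
Qed.

Lemma integrable_gauss (a : R) : 0 < a ->
  mu.-integrable setT (EFin \o (fun x => expR (- (a * x ^+ 2)))).
Proof.
move=> a0; rewrite (_ : _ \o _ = fun x => ((Num.sqrt (pi / a))%:E *
    (normal_pdf 0 (Num.sqrt (2 * a)^-1) x)%:E)%E).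
  exact: (integrableZl measurableT _ (integrable_normal_pdf _ _)).
by apply/funext => x; rewrite /= gauss_normal_pdf.
Qed.

Lemma Rintegral_gauss (a : R) : 0 < a ->
  Rintegral mu setT (fun x => expR (- (a * x ^+ 2))) = Num.sqrt (pi / a).
Proof.
move=> a0; under eq_Rintegral do rewrite gauss_normal_pdf//.
rewrite RintegralZl//; last exact: integrable_normal_pdf.
by rewrite /Rintegral integral_normal_pdf mulr1.
Qed.

Lemma expr_le_expR (b y : R) k : 0 < b -> 0 <= y ->
  y ^+ k <= (k.+1%:R / b) ^+ k * expR (b * y).
Proof.
(* Dividing by [k.+1] rather than [k] keeps [B] positive at [k = 0]; the estimate is the [k]-th
   power of $By \le e^{By}$. *)
move=> b0 y0; pose B := b / k.+1%:R.
have B0 : 0 < B by rewrite divr_gt0.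
have -> : k.+1%:R / b = B^-1 by rewrite invf_div.
have h1 : B * y <= expR (B * y).
  by have := expR_ge1Dx (B * y); lra.
have h2 : (B * y) ^+ k <= expR (b * y).
  apply: (@le_trans _ _ (expR (B * y) ^+ k)).
    by apply: lerXn2r => //; rewrite nnegrE ?expR_ge0// mulr_ge0// ltW.
  rewrite -expRM_natl ler_expR mulrA ler_wpM2r// /B.
  by rewrite mulrA ler_pdivrMr// mulrC ler_pM2l// ler_nat.
rewrite exprVn -[leLHS]mul1r -(mulVf (expf_neq0 k (lt0r_neq0 B0))) -mulrA -exprMn.
by rewrite ler_wpM2l// invr_ge0 exprn_ge0// ltW.
Qed.

Lemma continuous_poly_expR (p q : {poly R}) :
  continuous (fun x => p.[x] * expR q.[x]).
Proof.
move=> x; apply: (@cvgM _ _ (nbhs x)); first exact: continuous_horner.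
apply: (@continuous_comp _ _ _ (horner q) expR); last exact: continuous_expR.
exact: continuous_horner.
Qed.

(** One half of the Gaussian exponent absorbs the power of $x$, the other half remains as an
    integrable majorant. *)
Lemma integrable_Xn_gauss (a : R) k : 0 < a ->
  mu.-integrable setT (EFin \o (fun x => x ^+ k * expR (- (a * x ^+ 2)))).
Proof.
move=> a0; pose b := a / 2; have b0 : 0 < b by rewrite divr_gt0.
pose K := 1 + (k.+1%:R / b) ^+ k.
have K0 : 0 <= K by rewrite addr_ge0// exprn_ge0// divr_ge0// ltW.
have := integrableZl measurableT K (integrable_gauss _ b0).
apply: le_integrable => //.
  apply/measurable_EFinP; apply: continuous_measurable_fun.
  rewrite (_ : (fun _ => _) = fun x => ('X^k).[x] * expR (- a *: 'X^2).[x]).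
    exact: continuous_poly_expR.
  by apply/funext => x; rewrite hornerZ !hornerXn mulNr.
move=> x _ /=; rewrite lee_fin !normrM (ger0_norm K0) !(ger0_norm (expR_ge0 _)).
have -> : expR (- (a * x ^+ 2)) = expR (- (b * x ^+ 2)) * expR (- (b * x ^+ 2)).
  by rewrite -expRD; congr expR; rewrite /b; field.
rewrite mulrA ler_wpM2r ?expR_ge0//.
(* From $y \le 1 + y^2$; this trades a possibly odd power for a power of $x^2$. *)
have hx : `|x ^+ k| <= 1 + (x ^+ 2) ^+ k.
  rewrite -exprM mulnC exprM -(real_normK (num_real (x ^+ k))); set y := `|_|.
  by have := sqr_ge0 (y - 2^-1); rewrite sqrrB; lra.
have h1 := expr_le_expR b (x ^+ 2) k b0 (sqr_ge0 x).
have e1 : 1 <= expR (b * x ^+ 2) by rewrite -expR0 ler_expR mulr_ge0 ?sqr_ge0// ltW.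
have -> : K = K * expR (b * x ^+ 2) * expR (- (b * x ^+ 2)).
  by rewrite -mulrA -expRD subrr expR0 mulr1.
rewrite ler_wpM2r ?expR_ge0// (le_trans hx)// /K mulrDl mul1r.
exact: lerD.
Qed.

End GaussianDomination.

(** * From weights to moment functionals *)

Section PolynomialMoments.
Context {R : realType}.
Local Notation mu := (@lebesgue_measure R).

Definition mom (w : R -> R) k := Rintegral mu setT (fun x => x ^+ k * w x).

(** The exponential form gives positivity and continuity, the bound gives integrability against
    every polynomial. *)
Definition gauss_dominated (w : R -> R) := exists q a K,
  [/\ 0 < a, forall x, w x = expR q.[x] &
      forall x, w x <= K * expR (- (a * x ^+ 2))].

Variable w : R -> R.
Hypothesis gw : gauss_dominated w.

Lemma continuous_poly_weight (p : {poly R}) : continuous (fun x => p.[x] * w x).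
Proof.
have [q [a [K [_ wE _]]]] := gw.
rewrite (_ : (fun _ => _) = fun x => p.[x] * expR q.[x]).
  exact: continuous_poly_expR.
by apply/funext => x; rewrite wE.
Qed.

Lemma weight_gt0 x : 0 < w x.
Proof. by have [q [a [K [_ -> _]]]] := gw; exact: expR_gt0. Qed.

Lemma integrable_Xn_weight k :
  mu.-integrable setT (EFin \o (fun x => x ^+ k * w x)).
Proof.
have [q [a [K [a0 wE wK]]]] := gw.
have := integrableZl measurableT K (integrable_Xn_gauss a k a0).
apply: le_integrable => //.
  apply/measurable_EFinP; apply: continuous_measurable_fun.
  rewrite (_ : (fun _ => _) = fun x => ('X^k).[x] * w x).
    exact: continuous_poly_weight.
  by apply/funext => x; rewrite hornerXn.
move=> x _ /=; rewrite lee_fin mulrCA !normrM ler_wpM2l//.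
rewrite gtr0_norm ?weight_gt0// -normrM (le_trans (wK x))// ler_norm//.
Qed.

Lemma integrable_poly_weight (p : {poly R}) :
  mu.-integrable setT (EFin \o (fun x => p.[x] * w x)) /\
  Rintegral mu setT (fun x => p.[x] * w x) = Lm (mom w) p.
Proof.
rewrite (_ : (fun _ => _) =
  fun x => \sum_(i < size p) p`_i * (x ^+ i * w x)); last first.
  apply/funext => x; rewrite horner_coef mulr_suml.
  by apply: eq_bigr => i _; rewrite mulrA.
have h (i : 'I_(size p)) :
    mu.-integrable setT (EFin \o (fun x => p`_i * (x ^+ i * w x))).
  rewrite /comp; under eq_fun do rewrite EFinM.
  exact: (integrableZl measurableT _ (integrable_Xn_weight i)).
have [-> ->] := integrable_Rint_sum _ (index_enum _) _ h; split=> //.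
apply: eq_bigr => i _; rewrite RintegralZl//; exact: integrable_Xn_weight.
Qed.

Lemma Rintegral_poly_weight (p : {poly R}) :
  Rintegral mu setT (fun x => p.[x] * w x) = Lm (mom w) p.
Proof. by have [] := integrable_poly_weight p. Qed.

(** Beyond some [B] a monic polynomial is at least 1, so on $[B, B+1]$ the continuous integrand has
    a positive minimum. *)
Lemma Lm_mom_sqr_gt0 (p : {poly R}) : p \is monic -> 0 < Lm (mom w) (p ^+ 2).
Proof.
move=> /monicP pmon; rewrite -Rintegral_poly_weight.
have [B hB] : exists B, forall x, x >= B -> p.[x] >= lead_coef p.
  by apply: poly_pinfty_gt_lc; rewrite pmon.
pose f x := (p ^+ 2).[x] * w x.
have f0 x : 0 <= f x.
  by rewrite /f horner_exp mulr_ge0 ?sqr_ge0// ltW ?weight_gt0.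
have cf : continuous f by exact: continuous_poly_weight.
have [intf _] := integrable_poly_weight (p ^+ 2).
have BB : B <= B + 1 by lra.
have [c cB hc] := EVT_min BB (continuous_subspaceT cf).
have fc : 0 < f c.
  move: cB; rewrite in_itv /= => /andP[/hB + _]; rewrite pmon => pc.
  by rewrite /f horner_exp mulr_gt0 ?weight_gt0// exprn_gt0//; lra.
rewrite -lte_fin /Rintegral fineK; last exact: integrable_fin_num.
pose I : set R := `[B, B + 1]%classic.
have mI : measurable I by exact: measurable_itv.
apply: (@lt_le_trans _ _ (\int[mu]_(x in I) (f c)%:E)%E).
  rewrite integral_cst//= lebesgue_measure_itv/= ?lte_fin ltrDl ltr01.
  by rewrite -EFinD -EFinM lte_fin mulr_gt0//; lra.
apply: (@le_trans _ _ (\int[mu]_(x in I) (f x)%:E)%E).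
  apply: ge0_le_integral => //.
  - by move=> x _; rewrite lee_fin ltW.
  - by apply/measurable_EFinP/measurable_funTS; exact: continuous_measurable_fun.
apply: ge0_subset_integral => //.
- by apply/measurable_EFinP; exact: continuous_measurable_fun.
- by move=> x _; rewrite lee_fin f0.
Qed.

Lemma isOP_mom (P : nat -> {poly R}) b :
  monic_OP w P -> recurrence_beta w P b ->
  isOP (mom w) P b /\ forall n, hn w P n = sqnorm (mom w) P n.
Proof.
move=> mP rP.
have hE n : hn w P n = sqnorm (mom w) P n.
  rewrite /hn /sqnorm -Rintegral_poly_weight; apply: eq_Rintegral => x _.
  by rewrite horner_exp.
have h0 n : 0 < sqnorm (mom w) P n by apply: Lm_mom_sqr_gt0; case: (mP n).
split=> //; split=> // [n|n m mn|n].
- by case: (mP n) => ? [].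
- rewrite -Rintegral_poly_weight; case: (mP n) => _ [_ /(_ m mn) <-].
  by apply: eq_Rintegral => x _; rewrite hornerM.
- rewrite rP; congr (_ + _ *: _); case: n => [|n]; first by rewrite expr0n.
  by rewrite /gam !hE sqr_sqrtr// divr_ge0// ltW.
Qed.

Lemma gam_sqr (P : nat -> {poly R}) b n :
  monic_OP w P -> recurrence_beta w P b -> gam w P n ^+ 2 = gamma2 (mom w) P n.
Proof.
move=> mP rP; have [op hE] := isOP_mom _ _ mP rP.
case: n => [|n]; first by rewrite gamma2_0 expr0n.
by rewrite /gam !hE sqr_sqrtr// divr_ge0// ltW// (isOP_hgt0 _ _ _ op).
Qed.

End PolynomialMoments.

(** * Dilations and reflection in integrals over the line *)

Section LinearSubstitution.
Context {R : realType}.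
Local Notation mu := (@lebesgue_measure R).

Lemma ge0_integral_scale (r : R) (G : R -> R) : 0 < r -> continuous G ->
  (forall x, 0 <= G x) ->
  (\int[mu]_x (G x)%:E = \int[mu]_x (G (r * x) * r)%:E)%E.
Proof.
move=> r0 cG G0; have dF (x : R) : is_derive x 1 ( *%R r) r.
  by apply: (is_derive_eq (derZ _ _ _ r (is_derive_id x 1))); rewrite mulr1.
have FE : ( *%R r)^`()%classic = cst r.
  by apply/funext => x; rewrite derive1E; case: (dF x).
rewrite (increasing_ge0_integration_by_substitutionT (F := *%R r))//.
- by apply: eq_integral => x _; rewrite FE.
- by move=> x y xy; rewrite ltr_pM2l.
- by rewrite FE => ?; exact: cvg_cst.
- by rewrite FE; exact: is_cvg_cst.
- by rewrite FE; exact: is_cvg_cst.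
- exact: (gt0_cvgMrNy r0 cvg_id).
- exact: (gt0_cvgMry r0 cvg_id).
Qed.

(** Cut at 0 and folded onto the positive half-line, the two integrals have the same two pieces in
    opposite order. *)
Lemma ge0_integral_opp (G : R -> R) : continuous G -> (forall x, 0 <= G x) ->
  (\int[mu]_x (G x)%:E = \int[mu]_x (G (- x))%:E)%E.
Proof.
move=> cG G0.
have cGN : continuous (G \o -%R).
  by move=> x; apply: continuous_comp; [exact: opp_continuous|exact: cG].
have half (H : R -> R) : continuous H -> (forall x, 0 <= H x) ->
    (\int[mu]_x (H x)%:E = \int[mu]_(x in `[0%R, +oo[) (H (- x))%:E +
      \int[mu]_(x in `[0%R, +oo[) (H x)%:E)%E.
  move=> cH H0; have mH : measurable_fun setT H by exact: continuous_measurable_fun.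
  rewrite -(setUv `]-oo, (0:R)]%classic) setCitvl ge0_integral_setU//=; first last.
  - rewrite disj_set2E; apply/eqP; rewrite -subset0 => x []/= /[!in_itv]/=.
    by rewrite leNgt andbT => /negP.
  - by move=> x _; rewrite lee_fin.
  - by apply/measurable_EFinP; rewrite -setCitvl setUv.
  congr (_ + _)%E.
    rewrite -oppr0 ge0_integration_by_substitutionNy ?oppr0//.
    exact: continuous_subspaceT.
  by rewrite integral_itv_obnd_cbnd//; apply/measurable_EFinP/measurable_funTS.
rewrite (half G)// (half (G \o -%R))//= addeC; congr (_ + _)%E.
by apply: eq_integral => x _; rewrite opprK.
Qed.

(* Splitting [G = (|G| + G) - |G|] reduces signed integrands to nonnegative
   ones. *)
Lemma Rintegral_signed (r : R) (phi : R -> R) (G : R -> R) :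
  (forall H : R -> R, continuous H -> (forall x, 0 <= H x) ->
     (\int[mu]_x (H x)%:E = \int[mu]_x (H (phi x) * r)%:E)%E) ->
  continuous G -> mu.-integrable setT (EFin \o G) ->
  mu.-integrable setT (EFin \o (G \o phi)) ->
  Rintegral mu setT G = Rintegral mu setT (G \o phi) * r.
Proof.
move=> sub cG iG iGp.
have cN : continuous (Num.norm \o G).
  by move=> x; apply: continuous_comp; [exact: cG|exact: norm_continuous].
have cD : continuous (fun x => `|G x| + G x).
  by move=> x; apply: (@cvgD _ _ _ (nbhs x)); [exact: cN|exact: cG].
have D0 x : 0 <= `|G x| + G x by have := ler_norm (- G x); rewrite normrN; lra.
have iN := integrable_norm iG; have iNp := integrable_norm iGp.
have e1 := sub _ cD D0; have e2 := sub _ cN (fun x => normr_ge0 _).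
have {e1} : Rintegral mu setT (fun x => `|G x| + G x) =
    Rintegral mu setT (fun x => (`|G (phi x)| + G (phi x)) * r).
  by rewrite /Rintegral e1.
have {e2} : Rintegral mu setT (fun x => `|G x|) =
    Rintegral mu setT (fun x => `|G (phi x)| * r) by rewrite /Rintegral e2.
rewrite !RintegralZr//; last first.
  by rewrite /comp; under eq_fun do rewrite EFinD; exact: (integrableD _ iNp iGp).
by rewrite !RintegralD// => ->; rewrite mulrDl => /addrI.
Qed.

Lemma Rintegral_scale (r : R) (G : R -> R) : 0 < r -> continuous G ->
  mu.-integrable setT (EFin \o G) ->
  mu.-integrable setT (EFin \o (fun x => G (r * x))) ->
  Rintegral mu setT G = Rintegral mu setT (fun x => G (r * x)) * r.
Proof.
move=> r0; apply: Rintegral_signed => H cH H0; exact: ge0_integral_scale.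
Qed.

Lemma Rintegral_opp (G : R -> R) : continuous G ->
  mu.-integrable setT (EFin \o G) ->
  mu.-integrable setT (EFin \o (fun x => G (- x))) ->
  Rintegral mu setT G = Rintegral mu setT (fun x => G (- x)).
Proof.
rewrite -[X in _ -> _ -> _ -> _ = X]mulr1.
apply: Rintegral_signed => H cH H0; rewrite ge0_integral_opp//.
by apply: eq_integral => x _; rewrite mulr1.
Qed.

End LinearSubstitution.

(** * Moments of the deformed weights: scaling, continuity, derivative, limit *)

Section Weights.
Context {R : realType}.
Local Notation mu := (@lebesgue_measure R).
Variables (N d : nat) (V : {poly R}).
Hypotheses (d0 : (0 < d)%N) (N0 : (0 < N)%N).
Hypotheses (sV : size V = (2 * d).+1) (lV : 0 < lead_coef V).

(* [t] is clamped to [Num.max 1 t] so that the families below are defined and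
   continuous on the whole line. *)
Definition weight1 (t : R) : R -> R := weight N V (Num.max 1 t).

(* The weight in the variable $u = z / \sqrt t$, in which $t$ only enters
   through $e^{-N (t-1) u^2}$. *)
Definition uweight (t x : R) : R := expR (- (N%:R * ((t - 1) * x ^+ 2 + V.[x]))).

Definition uweight1 (t : R) : R -> R := uweight (Num.max 1 t).

Let NR0 : 0 < N%:R :> R. Proof. by rewrite ltr0n. Qed.

Lemma Vt_horner t : 1 <= t ->
  Vt V t =1 horner ((1 - t^-1) *: 'X^2 + (V \Po ((Num.sqrt t)^-1 *: 'X))).
Proof. by move=> t1 x; rewrite /Vt hornerD horner_comp !hornerZ hornerXn hornerX. Qed.

(** One Gaussian majorant for both weights and all $t \ge 1$; it dominates every passage to the
    limit and differentiation under the integral below. *)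
Lemma weights_bound : exists a K, 0 < a /\ forall t x, 1 <= t ->
  weight N V t x <= K * expR (- (a * x ^+ 2)) /\
  uweight t x <= K * expR (- (a * x ^+ 2)).
Proof.
have [c [C [c0 c1 hV]]] := quadratic_lower_bound V d d0 sV lV.
exists (N%:R * c), (expR (N%:R * C)); split; first exact: mulr_gt0.
move=> t x t1; rewrite /weight /uweight -expRD !ler_expR.
have t0 : 0 < t by lra.
have x2 := sqr_ge0 x.
have hN y : c * x ^+ 2 - C <= y ->
    - (N%:R * y) <= N%:R * C - N%:R * c * x ^+ 2.
  by rewrite -(ler_pM2l NR0); lra.
split; apply: hN.
  rewrite /Vt; set s := (Num.sqrt t)^-1.
  have s2 : s ^+ 2 = t^-1 by rewrite exprVn sqr_sqrtr// ltW.
  have := hV (s * x); rewrite exprMn s2 => h.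
  have it : 0 <= 1 - t^-1 by rewrite subr_ge0 invf_le1.
  (* This is $(1 - t^{-1}) + c\,t^{-1} \ge c$, valid since $c \le 1$. *)
  have : 0 <= (1 - t^-1) * (1 - c) * x ^+ 2.
    by apply: mulr_ge0 x2; apply: mulr_ge0 => //; lra.
  lra.
have : 0 <= (t - 1) * x ^+ 2 by apply: mulr_ge0 x2; lra.
by have := hV x; lra.
Qed.

Lemma gauss_dominated_weight t : 1 <= t -> gauss_dominated (weight N V t).
Proof.
move=> t1; have [a [K [a0 hK]]] := weights_bound.
exists (- (N%:R *: ((1 - t^-1) *: 'X^2 + (V \Po ((Num.sqrt t)^-1 *: 'X))))), a, K.
split=> // x; last by have [] := hK t x t1.
by rewrite hornerN hornerZ -Vt_horner.
Qed.

Lemma gauss_dominated_uweight t : 1 <= t -> gauss_dominated (uweight t).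
Proof.
move=> t1; have [a [K [a0 hK]]] := weights_bound.
exists (- (N%:R *: ((t - 1) *: 'X^2 + V))), a, K.
by split=> // x; [rewrite /uweight !hornerE|have [] := hK t x t1].
Qed.

Let max1 (t : R) : 1 <= Num.max 1 t. Proof. by rewrite le_max lexx. Qed.

Lemma mom_scaling t k : 1 <= t ->
  mom (weight N V t) k = Num.sqrt t ^+ k.+1 * mom (uweight t) k.
Proof.
move=> t1; set r := Num.sqrt t; have t0 : 0 < t by lra.
have r0 : 0 < r by rewrite sqrtr_gt0.
have wu x : weight N V t (r * x) = uweight t x.
  rewrite /weight /uweight /Vt mulKf ?gt_eqF//.
  rewrite exprMn sqr_sqrtr ?ltW// mulrA mulrBl mul1r mulVf ?gt_eqF//.
have gu := gauss_dominated_uweight t t1; have gz := gauss_dominated_weight t t1.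
have E : (fun x => (r * x) ^+ k * weight N V t (r * x)) =
    fun x => r ^+ k * (x ^+ k * uweight t x).
  by apply/funext => x; rewrite wu exprMn mulrA.
have iu := integrable_Xn_weight _ gu k.
rewrite /mom (Rintegral_scale r (fun x => x ^+ k * weight N V t x))//.
- by rewrite E RintegralZl// exprSr; ring.
- rewrite (_ : (fun _ => _) = fun x => ('X^k).[x] * weight N V t x).
    exact: continuous_poly_weight.
  by apply/funext => x; rewrite hornerXn.
- exact: integrable_Xn_weight.
- rewrite E /comp; under eq_fun do rewrite EFinM.
  exact: (integrableZl measurableT _ iu).
Qed.

Lemma mom_uweight1 t k :
  mom (uweight1 t) k = rescM (mom (weight1 t)) (Num.sqrt (Num.max 1 t)) k.
Proof.
rewrite /rescM /weight1 mom_scaling// mulrA -exprMn mulVf ?expr1n ?mul1r//.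
by rewrite gt_eqF// sqrtr_gt0 (lt_le_trans _ (max1 t)).
Qed.

Lemma cvg_mom_uweight1 k (t0 : R) :
  mom (uweight1 t) k @[t --> t0] --> mom (uweight1 t0) k.
Proof.
have [a [K [a0 hK]]] := weights_bound.
pose G x := K * `|x ^+ k * expR (- (a * x ^+ 2))|.
have iG : mu.-integrable setT (EFin \o G).
  rewrite /comp /G; under eq_fun do rewrite EFinM.
  exact: (integrableZl measurableT _ (integrable_norm (integrable_Xn_gauss a k a0))).
apply: (@continuity_under_integral _ _ _ mu (fun t x => x ^+ k * uweight1 t x)
  setT measurableT (t0 - 1) (t0 + 1) _ _ G iG _ t0) => //.
- by move=> t _; apply: integrable_Xn_weight; exact: gauss_dominated_uweight.
- apply: aeW => x _ t _; apply: (@cvgM _ _ (nbhs t)); first exact: cvg_cst.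
  apply: continuous_cvg; first exact: continuous_expR.
  apply: cvgN; apply: cvgM; first exact: cvg_cst.
  apply: cvgD; last exact: cvg_cst.
  apply: cvgM; last exact: cvg_cst.
  apply: cvgB; last exact: cvg_cst.
  exact: continuous_max (cvg_cst _) cvg_id.
- move=> t _; apply: aeW => x _; rewrite /G normrM normrM.
  rewrite mulrCA ler_wpM2l// !gtr0_norm ?expR_gt0//.
  by have [] := hK _ x (max1 t).
- by rewrite inE/= in_itv/=; apply/andP; split; lra.
Qed.

Lemma is_derive_mom_uweight1 k (t0 : R) : 1 < t0 ->
  is_derive t0 1 (fun t => mom (uweight1 t) k)
    (- N%:R * mom (uweight1 t0) k.+2).
Proof.
move=> t01; have [a [K [a0 hK]]] := weights_bound.
have mE (t : R) : 1 < t -> Num.max 1 t = t by move=> ?; apply/max_idPr/ltW.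
pose G x := N%:R * (K * `|x ^+ k.+2 * expR (- (a * x ^+ 2))|).
have iG : mu.-integrable setT (EFin \o G).
  rewrite /comp /G; under eq_fun do rewrite !EFinM.
  exact: (integrableZl measurableT _ (integrableZl measurableT _
    (integrable_norm (integrable_Xn_gauss a k.+2 a0)))).
pose f t x := x ^+ k * uweight t x.
have df (t x : R) : is_derive t 1 (f^~ x) (- N%:R * (x ^+ k.+2 * uweight t x)).
  have h := derN _ _ _ (derZ _ _ _ N%:R (derD _ _ _ _ _ (derM _ _ _ _ _
    (derD _ _ _ _ _ (is_derive_id t (1 : R)) (derC t (- 1))) (derC t (x ^+ 2)))
    (derC t V.[x]))).
  apply: (is_derive_eq (derZ _ _ _ (x ^+ k)
    (is_derive1_comp (is_derive_expR _) h))).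
  by rewrite /uweight !exprS; ring.
(* To the right of 1 the clamp is inactive and the uniform majorant applies. *)
pose I : set R := `]1, (t0 + 1)[%classic.
have It0 : I t0 by rewrite /I /= in_itv/=; apply/andP; split; lra.
have intf t : I t -> mu.-integrable setT (EFin \o f t).
  rewrite /I /= in_itv/= => /andP[t1 _]; apply: integrable_Xn_weight.
  by apply: gauss_dominated_uweight; exact: ltW.
have derf t x : I t -> setT x -> derivable (f^~ x) t 1.
  by move=> _ _; exact: ex_derive.
have pE t x : partial1of2 f t x = - N%:R * (x ^+ k.+2 * uweight t x).
  by rewrite partial1of2E; case: (df t x).
have G0 x : 0 <= G x.
  rewrite /G !mulr_ge0// ?ltW//.
  have [+ _] := hK 1 x (lexx _); move=> /(lt_le_trans (expR_gt0 _)).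
  by rewrite pmulr_lgt0 ?expR_gt0.
have Gub t x : I t -> setT x -> `|partial1of2 f t x| <= G x.
  rewrite /I /= in_itv/= => /andP[t1 _] _; rewrite pE /G normrM normrN (gtr0_norm NR0).
  rewrite ler_pM2l// !normrM mulrCA ler_wpM2l// !gtr0_norm ?expR_gt0//.
  by have [] := hK t x (ltW t1).
have dF := derivable_under_integral measurableT It0 intf derf G0 iG Gub.
have eF := differentiation_under_integral measurableT It0 intf derf G0 iG Gub.
apply: (@near_eq_is_derive _ _ _ (fun t => \int[mu]_x f t x)).
  near=> t; apply: eq_Rintegral => x _; rewrite /uweight1 mE//.
  near: t; exact: lt_nbhsr.
apply: DeriveDef => //; rewrite -derive1E eF /mom /uweight1 mE// -RintegralZl//.
  by apply: eq_Rintegral => x _; rewrite pE.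
by apply: integrable_Xn_weight; apply: gauss_dominated_uweight; exact: ltW.
Unshelve. all: by end_near. Qed.

Lemma cvg_mom_weight1 k : V`_0 = 0 ->
  mom (weight1 t) k @[t --> +oo] --> mom (fun x => expR (- (N%:R * x ^+ 2))) k.
Proof.
move=> V0; have [a [K [a0 hK]]] := weights_bound.
apply/cvg_pinftyP => u uy.
have uM : Num.max 1 (u n) @[n --> \oo] --> +oo.
  apply/cvgryPge => A; near=> n; rewrite le_max; apply/orP; right.
  by near: n; move/cvgryPge : uy; exact.
have uV : (Num.max 1 (u n))^-1 @[n --> \oo] --> 0.
  by apply/gtr0_cvgV0 => //; apply: nearW => n; rewrite lt_max ltr01.
have uS : (Num.sqrt (Num.max 1 (u n)))^-1 @[n --> \oo] --> 0.
  rewrite -sqrtr0; under eq_fun do rewrite -sqrtrV ?(le_trans ler01)//.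
  by apply: continuous_cvg uV; exact: sqrt_continuous.
pose G x := K * `|x ^+ k * expR (- (a * x ^+ 2))|.
have iG : mu.-integrable setT (EFin \o G).
  rewrite /comp /G; under eq_fun do rewrite EFinM.
  exact: (integrableZl measurableT _ (integrable_norm (integrable_Xn_gauss a k a0))).
have iw n : mu.-integrable setT (EFin \o (fun x => x ^+ k * weight1 (u n) x)).
  by apply: integrable_Xn_weight; exact: gauss_dominated_weight.
apply: fine_cvg; rewrite fineK; last first.
  exact: integrable_fin_num _ (integrable_Xn_gauss _ k NR0).
apply: (@dominated_cvg _ _ _ mu setT measurableT
  (fun n x => (x ^+ k * weight1 (u n) x)%:E) _ (EFin \o G)) => //.
- by move=> n; exact: measurable_int (iw n).
- move=> x _; apply: cvg_EFin; first exact: nearW.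
  have h : Vt V (Num.max 1 (u n)) x @[n --> \oo] --> (1 - 0) * x ^+ 2 + V.[0 * x].
    apply: cvgD.
      by apply: cvgM; [apply: cvgB; [exact: cvg_cst|exact: uV]|exact: cvg_cst].
    apply: continuous_cvg; first exact: continuous_horner.
    by apply: cvgM; [exact: uS|exact: cvg_cst].
  (* The limiting potential is $x^2 + V(0)$, and $V$ has no constant term. *)
  rewrite mul0r horner_coef0 V0 subr0 mul1r addr0 in h.
  apply: cvgM; first exact: cvg_cst.
  apply: continuous_cvg; first exact: continuous_expR.
  by apply: cvgN; apply: cvgM; [exact: cvg_cst|exact: h].
- move=> n x _; rewrite lee_fin /G normrM normrM.
  rewrite mulrCA ler_wpM2l// !gtr0_norm ?expR_gt0//.
  by have [] := hK _ x (max1 (u n)).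
Unshelve. all: by end_near. Qed.

End Weights.

(* Monic Hermite polynomials for the weight $e^{-x^2 / (2 a)}$, which only enters
   through its moment recursion. *)
Section Hermite.
Context {R : realFieldType}.
Variables (a : R) (G : nat -> R).
Hypotheses (a0 : 0 < a) (G0 : 0 < G 0) (G1 : G 1%N = 0).
Hypothesis GSS : forall k, G k.+2 = k.+1%:R * a * G k.

Fixpoint hermite n : {poly R} :=
  if n is m.+1 then 'X * hermite m - (m%:R * a) *: hermite m.-1 else 1.

Lemma hermiteS n :
  hermite n.+1 = 'X * hermite n - (n%:R * a) *: hermite n.-1.
Proof. by []. Qed.

(** Gaussian integration by parts read on monomials: [G1] is the case of constants, [GSS] that of
    the positive powers. *)
Lemma Lm_mulX (q : {poly R}) : Lm G ('X * q) = a * Lm G q^`().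
Proof.
case: (posnP (size q)) => [/eqP|sq].
  by rewrite size_poly_eq0 => /eqP ->; rewrite mulr0 deriv0 linear0 mulr0.
rewrite (LmE _ ('X * q) (size q).+1); last first.
  by rewrite (leq_trans (size_polyMleq _ _))// size_polyX.
rewrite (LmE _ _ (size q).-1); last first.
  by rewrite -ltnS prednK// (leq_trans (lt_size_deriv _))// -size_poly_gt0.
rewrite -(prednK sq) big_ord_recl coefXM mul0r add0r big_ord_recl coefXM /=.
rewrite G1 mulr0 add0r mulr_sumr; apply: eq_bigr => i _.
by rewrite coefXM /= /bump /= !add1n coef_deriv GSS -mulr_natr; ring.
Qed.

Lemma deriv_hermite n : (hermite n)^`() = n%:R *: hermite n.-1.
Proof.
suff : (hermite n)^`() = n%:R *: hermite n.-1 /\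
       (hermite n.+1)^`() = n.+1%:R *: hermite n by case.
elim: n => [|n [IH0 IH1]].
  by rewrite hermiteS !mul0r !scale0r subr0 /= mulr1 derivX derivC scale1r.
split=> //; transitivity (hermite n.+1 +
    n.+1%:R *: ('X * hermite n - (n%:R * a) *: hermite n.-1)); last first.
  by rewrite -hermiteS -[n.+2%:R]nat1r scalerDl scale1r.
rewrite hermiteS derivB derivM derivX derivZ IH0 IH1 mul1r /=.
rewrite -scalerAr scalerA scalerBr scalerA addrA.
by congr (_ - _ *: _); ring.
Qed.

(** By [deriv_hermite], $H_{n+1} = xH_n - aH_n'$; the operator $x - a\,d/dx$ is the adjoint of
    $a\,d/dx$ for the Gaussian functional. *)
Lemma Lm_hermiteS n (q : {poly R}) :
  Lm G (hermite n.+1 * q) = a * Lm G (hermite n * q^`()).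
Proof.
rewrite hermiteS mulrBl -mulrA -scalerAl -scaleNr LmD LmZ Lm_mulX.
by rewrite derivM deriv_hermite -scalerAl LmD LmZ; ring.
Qed.

Lemma Lm_hermite_lt n (q : {poly R}) :
  (size q <= n)%N -> Lm G (hermite n * q) = 0.
Proof.
elim: n q => [|n IHn] q qn.
  by move: qn; rewrite leqn0 size_poly_eq0 => /eqP ->; rewrite mulr0 linear0.
rewrite Lm_hermiteS IHn ?mulr0//.
case: (eqVneq q 0) => [->|q0]; first by rewrite deriv0 size_poly0.
by rewrite -ltnS (leq_trans (lt_size_deriv q0)).
Qed.

Lemma hermite_monic n : hermite n \is monic /\ size (hermite n) = n.+1.
Proof.
suff : forall m, (m <= n)%N -> hermite m \is monic /\ size (hermite m) = m.+1.
  by apply.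
elim: n => [|n IHn] m; first by rewrite leqn0 => /eqP ->; rewrite monic1 size_poly1.
rewrite leq_eqVlt => /orP[/eqP ->|]; last exact: IHn.
have [mon sz] := IHn n (leqnn _).
have sX : size ('X * hermite n) = n.+2.
  by rewrite mulrC size_mulX ?sz// -size_poly_gt0 sz.
have lt : (size (- ((n%:R * a) *: hermite n.-1)) < size ('X * hermite n)%R)%N.
  rewrite sX size_polyN (leq_ltn_trans (size_scale_leq _ _))//.
  have [_ ->] := IHn n.-1 (leq_pred _).
  by rewrite ltnS ltnS leq_pred.
rewrite hermiteS size_polyDl//; split=> //.
by apply/monicP; rewrite lead_coefDl// lead_coefM lead_coefX mul1r; exact/monicP.
Qed.

Lemma sqnorm_hermite n : sqnorm G hermite n = n`!%:R * a ^+ n * G 0.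
Proof.
elim: n => [|n IHn].
  by rewrite /sqnorm /= expr1n -(expr0 'X) LmXn fact0 expr0 !mul1r.
rewrite /sqnorm expr2 Lm_hermiteS deriv_hermite -scalerAr LmZ -expr2.
rewrite -/(sqnorm G hermite n).
by rewrite IHn factS natrM exprS; ring.
Qed.

Lemma gamma2_hermite n : gamma2 G hermite n = n%:R * a.
Proof.
case: n => [|n]; first by rewrite gamma2_0 mul0r.
rewrite /gamma2 !sqnorm_hermite factS natrM exprS; field.
by rewrite expf_neq0 ?(gt_eqF a0)// (gt_eqF G0) pnatr_eq0 -lt0n fact_gt0.
Qed.

Lemma isOP_hermite : isOP G hermite (fun=> 0).
Proof.
have h0 n : 0 < sqnorm G hermite n.
  by rewrite sqnorm_hermite !mulr_gt0 ?exprn_gt0// ltr0n fact_gt0.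
split=> [n|n m mn|//|n].
- exact: hermite_monic.
- have sz k : size (hermite k) = k.+1 by case: (hermite_monic k).
  case: (ltngtP n m) => [nm|nm|e]; last by case: mn.
    by rewrite mulrC Lm_hermite_lt// sz.
  by rewrite Lm_hermite_lt// sz.
by rewrite scale0r addr0 gamma2_hermite hermiteS subrK.
Qed.

End Hermite.

(** * The Gaussian weight and its moments *)

Section GaussianMoments.
Context {R : realType}.
Local Notation mu := (@lebesgue_measure R).
Variable N : nat.
Hypothesis N0 : (0 < N)%N.

Definition gweight (x : R) : R := expR (- (N%:R * x ^+ 2)).

Let NR0 : 0 < N%:R :> R. Proof. by rewrite ltr0n. Qed.

(** For $V = z^2$ the deformation is stationary, so the general results on [weight] apply to the
    Gaussian weight. *)
Let weightX2 t : 1 <= t -> weight N 'X^2 t = gweight.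
Proof.
move=> t1; apply/funext => x; rewrite /weight /gweight /Vt hornerXn exprMn.
rewrite exprVn sqr_sqrtr; last by lra.
by congr (expR (- (_ * _))); ring.
Qed.

Let sX2 : size ('X^2 : {poly R}) = (2 * 1).+1. Proof. by rewrite size_polyXn. Qed.
Let lX2 : 0 < lead_coef ('X^2 : {poly R}). Proof. by rewrite lead_coefXn. Qed.

Lemma gauss_dominated_gweight : gauss_dominated gweight.
Proof.
by rewrite -(weightX2 1)//; exact: (gauss_dominated_weight _ 1 'X^2).
Qed.

Lemma mom_gweight0 : mom gweight 0 = Num.sqrt (pi / N%:R).
Proof.
by rewrite -(Rintegral_gauss _ NR0); apply: eq_Rintegral => x _; rewrite expr0 mul1r.
Qed.

Lemma mom_gweight1 : mom gweight 1 = 0.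
Proof.
have gd := gauss_dominated_gweight; have i1 := integrable_Xn_weight _ gd 1.
have E : (fun x : R => (- x) ^+ 1 * gweight (- x)) =
    fun x => -1 * (x ^+ 1 * gweight x).
  by apply/funext => x; rewrite /gweight sqrrN !expr1; ring.
have : mom gweight 1 = - mom gweight 1.
  rewrite {1}/mom (Rintegral_opp (fun x => x ^+ 1 * gweight x))//.
  - by rewrite E RintegralZl// mulN1r.
  - rewrite (_ : (fun _ => _) = fun x => ('X^1).[x] * gweight x).
      exact: continuous_poly_weight.
    by apply/funext => x; rewrite hornerXn.
  - rewrite E /comp; under eq_fun do rewrite EFinM.
    exact: (integrableZl measurableT _ i1).
by move=> ?; lra.
Qed.

(* Differentiating the scaling relation [mom (uweight (r^2)) k * r^(k+1) = const]
   in [r] gives the Gaussian moment recursion. *)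
Lemma mom_gweightSS k :
  mom gweight k.+2 = k.+1%:R * (2 * N%:R)^-1 * mom gweight k.
Proof.
have scale (r : R) j : 1 < r ->
    mom (uweight1 N 'X^2 (r * r)) j * r ^+ j.+1 = mom gweight j.
  move=> r1; have rr : 1 <= r * r by nra.
  rewrite /uweight1 (max_idPr rr) -(weightX2 _ rr) (mom_scaling _ 1)//.
  by rewrite -expr2 sqrtr_sqr ger0_norm; [rewrite mulrC|lra].
have dX (n : nat) (r : R) : is_derive r 1 (fun x => x ^+ n.+1) (n.+1%:R * r ^+ n).
  elim: n => [|n IHn].
    by rewrite mul1r expr0; exact: is_derive_id.
  rewrite (_ : (fun _ => _) = fun x => x * x ^+ n.+1); last first.
    by apply/funext => x; rewrite exprS.
  apply: (is_derive_eq (derM _ _ _ _ _ (is_derive_id r (1 : R)) IHn)).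
  by rewrite -[n.+2%:R]natr1 exprS; ring.
(* The recursion does not involve [r]; any point with $r^2 > 1$, where the derivative of the moments
   is known, will do. *)
have [r r1] : exists r : R, 1 < r by exists 2; lra.
have rr : 1 < r * r by nra.
have d1 := @is_derive1_comp R (fun t => mom (uweight1 N 'X^2 t) k) (fun t => t * t)
  r _ _ (is_derive_mom_uweight1 _ 1 'X^2 isT N0 sX2 lX2 k _ rr)
  (derM _ _ _ _ _ (is_derive_id r (1 : R)) (is_derive_id r (1 : R))).
have d2 := derM _ _ _ _ _ d1 (dX k r).
have d3 : is_derive r 1 (fun x => mom (uweight1 N 'X^2 (x * x)) k * x ^+ k.+1) 0.
  apply: (near_eq_is_derive _ (derC r (mom gweight k))).
  near=> x; rewrite scale//; near: x; exact: lt_nbhsr.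
have := der_uniq _ _ _ _ d2 d3.
have := scale r k r1; have := scale r k.+2 r1.
set m2 := mom _ k.+2; set m0 := mom _ k => e2 e0.
rewrite -e2 -e0 /= => h.
have rk : r ^+ k != 0 by rewrite expf_neq0 // gt_eqF//; lra.
have {h} : m0 * k.+1%:R - 2 * N%:R * m2 * r ^+ 2 = 0.
  by apply: (mulIf rk); rewrite mul0r -[RHS]h -/m0 [r ^+ k.+1]exprS; ring.
move=> h; have nn : N%:R != 0 :> R by rewrite gt_eqF.
have rn := gt_eqF (lt_trans ltr01 r1).
rewrite (_ : m2 = (m0 * k.+1%:R) / (2 * N%:R * r ^+ 2)).
  by rewrite !exprS; field; rewrite nn rn.
have {}h : m0 * k.+1%:R = 2 * N%:R * m2 * r ^+ 2 by lra.
by rewrite h; field; rewrite nn rn.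
Unshelve. all: by end_near. Qed.

End GaussianMoments.

(** * The free energy, its derivatives and its limit *)

Section FreeEnergy.
Context {R : realType}.
Local Notation mu := (@lebesgue_measure R).
Variables (d N : nat) (V : {poly R}).
Variables (P : R -> nat -> {poly R}) (beta : R -> nat -> R).
Hypotheses (d0 : (0 < d)%N) (N0 : (0 < N)%N) (V0 : V`_0 = 0).
Hypotheses (sV : size V = (2 * d).+1) (lV : 0 < lead_coef V).
Hypothesis monP : forall tau, 1 <= tau -> monic_OP (weight N V tau) (P tau).
Hypothesis recP : forall tau, 1 <= tau ->
  recurrence_beta (weight N V tau) (P tau) (beta tau).

Let m (t : R) : R := Num.max 1 t.
Let r (t : R) : R := Num.sqrt (m t).
(** The suffix [z] marks the original variable and [u] the rescaled one. Clamping [t] yields an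
    [isOP] family for every real [t], although [monP] and [recP] start at 1. *)
Let Mz t := mom (weight1 N V t).
Let Pz t := P (m t).
Let bz t := beta (m t).
Let Mu t := mom (uweight1 N V t).
Let Pu t := rescP (Pz t) (r t).
Let bu t n := (r t)^-1 * bz t n.

Let NR0 : 0 < N%:R :> R. Proof. by rewrite ltr0n. Qed.

Let m_ge1 t : 1 <= m t. Proof. by rewrite le_max lexx. Qed.

Let m_gt0 t : 0 < m t. Proof. exact: lt_le_trans (m_ge1 t). Qed.

Let mE t : 1 <= t -> m t = t. Proof. by move=> /max_idPr. Qed.

Let r_gt0 t : 0 < r t. Proof. by rewrite sqrtr_gt0. Qed.

Let r_sqr t : r t ^+ 2 = m t. Proof. by rewrite sqr_sqrtr// ltW. Qed.

Let opz t : isOP (Mz t) (Pz t) (bz t).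
Proof.
by have [] := isOP_mom _ (gauss_dominated_weight N d V d0 N0 sV lV _ (m_ge1 t))
  _ _ (monP _ (m_ge1 t)) (recP _ (m_ge1 t)).
Qed.

Let MuE t : Mu t = rescM (Mz t) (r t).
Proof. by apply/funext => k; exact: (mom_uweight1 N d). Qed.

Let opu t : isOP (Mu t) (Pu t) (bu t).
Proof. by rewrite MuE; exact: isOP_resc. Qed.

Let sqnorm_u t n : sqnorm (Mz t) (Pz t) n = r t ^+ n.*2.+1 * sqnorm (Mu t) (Pu t) n.
Proof.
by rewrite MuE sqnorm_resc// mulrA -exprMn divff ?expr1n ?mul1r// gt_eqF.
Qed.

Let jacobi2_diag_u t n :
  jacobi2_diag (Mz t) (Pz t) (bz t) n = m t * jacobi2_diag (Mu t) (Pu t) (bu t) n.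
Proof.
rewrite /jacobi2_diag MuE !(gamma2_resc _ _ _ _ (opz t))// -(r_sqr t) /bu.
by field; rewrite gt_eqF.
Qed.

Let jacobi2_offdiag_u t n :
  jacobi2_offdiag (Mz t) (Pz t) (bz t) n =
  m t ^+ 2 * jacobi2_offdiag (Mu t) (Pu t) (bu t) n.
Proof.
rewrite /jacobi2_offdiag MuE !(gamma2_resc _ _ _ _ (opz t))// -(r_sqr t) /bu.
by field; rewrite gt_eqF.
Qed.

Lemma FN_sqnorm t : 1 <= t ->
  FN N V t = - N%:R ^- 2 * ln (N`!%:R * \prod_(i < N) sqnorm (Mz t) (Pz t) i).
Proof.
move=> t1; rewrite /FN; congr (_ * ln _); rewrite /ZN.
have gd := gauss_dominated_weight N d V d0 N0 sV lV t t1.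
rewrite (_ : (fun s => _) = fun s =>
    ((\prod_(j < N) \prod_(k < N | (j < k)%N) (s`_j - s`_k) ^+ 2)
      * \prod_(j < N) weight N V t s`_j)%:E); last first.
  apply/funext => s; congr ((_ * _)%:E).
  by rewrite mulr_sumr -sumrN expR_sum.
have mp := monP t t1; rewrite (heine _ _ (P t)) /=; last 3 first.
- by move=> i; case: (mp i) => ? [].
- by move=> q; have [] := integrable_poly_weight _ gd q.
- by move=> i j ij; case: (mp i) => _ [_]; apply.
congr (_ * _); apply: eq_bigr => i _; rewrite /Mz /Pz /weight1 -/(m t) mE//.
by have [_ ->] := isOP_mom _ gd _ _ mp (recP t t1).
Qed.

(* [F0], [F1], [F2] are $F_N$, $F_N'$, $F_N''$ on $[1, \infty)$. *)
Let F0 t : R := - N%:R ^- 2 *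
  (ln N`!%:R + (N%:R ^+ 2 / 2) * ln (m t) + \sum_(i < N) ln (sqnorm (Mu t) (Pu t) i)).
Let F1 t : R :=
  - (2 * m t)^-1 + N%:R^-1 * \sum_(i < N) jacobi2_diag (Mu t) (Pu t) (bu t) i.
Let F2 t : R := (2 * m t ^+ 2)^-1 - jacobi2_offdiag (Mu t) (Pu t) (bu t) N.

Lemma ln_prod n (f : nat -> R) : (forall i, 0 < f i) ->
  ln (\prod_(i < n) f i) = \sum_(i < n) ln (f i).
Proof.
move=> f0; elim: n => [|n IHn]; first by rewrite !big_ord0 ln1.
by rewrite !big_ord_recr /= lnM ?IHn// posrE// prodr_gt0.
Qed.

Lemma FN_F0 t : 1 <= t -> FN N V t = F0 t.
Proof.
move=> t1; rewrite FN_sqnorm// /F0; congr (_ * _).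
have hz i := isOP_hgt0 _ _ _ (opz t) i; have hu i := isOP_hgt0 _ _ _ (opu t) i.
rewrite lnM ?posrE ?prodr_gt0// ?ltr0n ?fact_gt0// ln_prod// -addrA; congr (_ + _).
have lnr : ln (r t) = ln (m t) / 2.
  by rewrite -(r_sqr t) lnXn// -mulr_natr; field.
under eq_bigr do rewrite sqnorm_u lnM ?posrE ?exprn_gt0// lnXn// lnr.
(* The exponents $(2i+1)/2$ of $t$ in the norms add up to $N^2/2$. *)
rewrite big_split /=; congr (_ + _); elim: (N) => [|n IHn].
  by rewrite big_ord0 expr0n/= !mul0r.
rewrite big_ord_recr /=.
have -> : ln (m t) / 2 *+ n.*2.+1 = ln (m t) / 2 * (2 * n%:R + 1).
  by rewrite -mulr_natr -[n.*2.+1%:R]natr1 -mul2n natrM.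
by rewrite IHn -[n.+1%:R]natr1; field.
Qed.

Let der_m (t : R) : 1 < t -> is_derive t 1 m 1.
Proof.
move=> t1; apply: (near_eq_is_derive _ (is_derive_id t (1 : R))).
by near=> s; rewrite mE// ltW//; near: s; exact: lt_nbhsr.
Unshelve. all: by end_near. Qed.

Let dM (t : R) : 1 < t -> forall k,
  is_derive t 1 (fun s => Mu s k) (- N%:R * Mu t k.+2).
Proof. by move=> t1 k; exact: (is_derive_mom_uweight1 N d). Qed.

Let der_F0 (t : R) : 1 < t -> is_derive t 1 F0 (F1 t).
Proof.
move=> t1; have hs := der_sum t N (fun i s => ln (sqnorm (Mu s) (Pu s) i)) _
  (fun i => der_ln_sqnorm _ _ _ _ _ opu (dM t t1) i).
have hl := der_ln _ _ _ (m_gt0 t) (der_m t t1).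
apply: (is_derive_eq (derZ _ _ _ (- N%:R ^- 2)
  (derD _ _ _ _ _ (derD _ _ _ _ _ (derC t (ln N`!%:R))
    (derZ _ _ _ (N%:R ^+ 2 / 2) hl)) hs))).
rewrite /F1 -mulr_sumr; field.
by rewrite (gt_eqF (m_gt0 t)) (gt_eqF NR0).
Qed.

Let der_F1 (t : R) : 1 < t -> is_derive t 1 F1 (F2 t).
Proof.
move=> t1; have m2 : 2 * m t != 0 by rewrite mulf_neq0// gt_eqF.
have hv := derN _ _ _ (derV t (fun s => 2 * m s) _ m2 (derZ _ _ _ 2 (der_m t t1))).
have hs := derZ _ _ _ N%:R^-1 (der_sum_jacobi2_diag _ _ _ _ _ opu (dM t t1) N).
apply: (is_derive_eq (derD _ _ _ _ _ hv hs)).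
rewrite /F2; field.
by rewrite (gt_eqF (m_gt0 t)) (gt_eqF NR0).
Qed.

Let cvg_m (t0 : R) : m t @[t --> t0] --> m t0.
Proof. exact: continuous_max (cvg_cst _) cvg_id. Qed.

Let cvg_Mu (t0 : R) k : Mu t k @[t --> t0] --> Mu t0 k.
Proof. exact: (cvg_mom_uweight1 N d). Qed.

Let cvg_F0 (t0 : R) : F0 t @[t --> t0] --> F0 t0.
Proof.
apply: cvgM; first exact: cvg_cst.
apply: cvgD.
  apply: cvgD; first exact: cvg_cst.
  apply: cvgM; first exact: cvg_cst.
  by apply: continuous_cvg (cvg_m t0); exact: continuous_ln.
apply: (cvg_sumn (nbhs t0) N (fun i t => ln (sqnorm (Mu t) (Pu t) i))
  (fun i => ln (sqnorm (Mu t0) (Pu t0) i))) => i.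
apply: continuous_cvg; first exact/continuous_ln/(isOP_hgt0 _ _ _ (opu t0)).
exact: (cvg_sqnorm (nbhs t0) _ _ _ _ _ _ opu (opu t0) (cvg_Mu t0) i).
Qed.

Let cvg_F1 (t0 : R) : F1 t @[t --> t0] --> F1 t0.
Proof.
apply: cvgD.
  apply: cvgN; apply: cvgV; first by rewrite mulf_neq0// gt_eqF.
  by apply: cvgM; [exact: cvg_cst|exact: cvg_m].
apply: cvgM; first exact: cvg_cst.
apply: (cvg_sumn (nbhs t0) N (fun i t => jacobi2_diag (Mu t) (Pu t) (bu t) i)
  (fun i => jacobi2_diag (Mu t0) (Pu t0) (bu t0) i)) => i.
exact: (cvg_jacobi2_diag (nbhs t0) _ _ _ _ _ _ opu (opu t0) (cvg_Mu t0) i).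
Qed.

Let cvg_F2 (t0 : R) : F2 t @[t --> t0] --> F2 t0.
Proof.
apply: cvgB.
  apply: cvgV; first by rewrite mulf_neq0 ?expf_neq0// gt_eqF.
  by apply: cvgM; [exact: cvg_cst|rewrite expr2; apply: cvgM; exact: cvg_m].
exact: (cvg_jacobi2_offdiag (nbhs t0) _ _ _ _ _ _ opu (opu t0) (cvg_Mu t0) N).
Qed.

(** In $u$ the bracket loses a factor $\tau^2$, which cancels the denominator; the constant
    $\frac12$ becomes the second derivative of $-\frac12\ln\tau$. *)
Lemma integrandE t tau : 1 <= tau ->
  integrand N V P beta t tau = (tau - t) * F2 tau.
Proof.
move=> t1; have := jacobi2_offdiag_u tau N.
have gd := gauss_dominated_weight N d V d0 N0 sV lV tau t1.
rewrite /integrand !(gam_sqr _ gd _ _ _ (monP _ t1) (recP _ t1)).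
rewrite /F2 mE// /jacobi2_offdiag /Mz /Pz /bz /weight1 -/(m tau) mE// => e.
have -> : gamma2 (mom (weight N V tau)) (P tau) N *
  (gamma2 (mom (weight N V tau)) (P tau) N.-1 +
   gamma2 (mom (weight N V tau)) (P tau) N.+1 +
   beta tau N ^+ 2 + 2 * beta tau N * beta tau N.-1 + beta tau N.-1 ^+ 2) =
   tau ^+ 2 * (gamma2 (Mu tau) (Pu tau) N *
     (gamma2 (Mu tau) (Pu tau) N.-1 + gamma2 (Mu tau) (Pu tau) N.+1 +
      (bu tau N + bu tau N.-1) ^+ 2)).
  by rewrite -e; ring.
by field; rewrite gt_eqF//; lra.
Qed.

Lemma integrable_integrand t T : 1 <= t ->
  mu.-integrable `[t, T] (fun tau => (integrand N V P beta t tau)%:E).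
Proof.
move=> t1; have [tT|Tt] := leP t T; last first.
  by rewrite set_itv_ge ?bnd_simp -?ltNge//; exact: integrable_set0.
apply: (@eq_integrable _ _ _ mu _ _ (fun tau => ((tau - t) * F2 tau)%:E)) => //.
  move=> tau; rewrite inE/= in_itv/= => /andP[ttau _].
  by rewrite integrandE// (le_trans t1).
apply: continuous_compact_integrable; first exact: segment_compact.
apply: continuous_subspaceT => tau.
by apply: cvgM; [apply: cvgB; [exact: cvg_id|exact: cvg_cst]|exact: cvg_F2].
Qed.

Lemma Rintegral_integrand t T : 1 <= t -> t < T ->
  Rintegral mu `[t, T] (integrand N V P beta t) =
  (T - t) * F1 T - F0 T + F0 t.
Proof.
move=> t1 tT; pose A s := (s - t) * F1 s + - F0 s.
have cA (s : R) : A x @[x --> s] --> A s.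
  apply: cvgD; last by apply: cvgN; exact: cvg_F0.
  by apply: cvgM; [apply: cvgB; [exact: cvg_id|exact: cvg_cst]|exact: cvg_F1].
have dA (s : R) : 1 < s -> is_derive s 1 A ((s - t) * F2 s).
  move=> s1; apply: (is_derive_eq (derD _ _ _ _ _
    (derM _ _ _ _ _ (derD _ _ _ _ _ (is_derive_id s (1 : R)) (derC s (- t)))
      (der_F1 s s1)) (derN _ _ _ (der_F0 s s1)))).
  by ring.
have st (s : R) : s \in `]t, T[ -> 1 < s by rewrite in_itv/= => /andP[/(le_lt_trans t1)].
rewrite (@eq_Rintegral _ _ _ mu _ (fun tau => (tau - t) * F2 tau)); last first.
  move=> tau; rewrite inE => /itvP ttau.
  by apply: integrandE; rewrite (le_trans t1)// ttau.
rewrite /Rintegral (continuous_FTC2 (F := A) tT) //.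
- by rewrite -EFinB /= /A; ring.
- apply: continuous_subspaceT => tau.
  by apply: cvgM; [apply: cvgB; [exact: cvg_id|exact: cvg_cst]|exact: cvg_F2].
- split.
  + by move=> s /st/dA sA; exact: ex_derive.
  + exact/cvg_at_right_filter/cA.
  + exact/cvg_at_left_filter/cA.
- by move=> s /st/dA sA; rewrite derive1E; exact: derive_val.
Qed.

Let G := mom (gweight (R := R) N).
(** The variance that writes $e^{-Nx^2}$ as $e^{-x^2/(2a)}$. *)
Let a : R := (2 * N%:R)^-1.

Let a0 : 0 < a. Proof. by rewrite invr_gt0 mulr_gt0. Qed.

Let G00 : 0 < G 0%N.
Proof. by rewrite /G mom_gweight0// sqrtr_gt0 divr_gt0// pi_gt0. Qed.

Let opG : isOP G (hermite a) (fun=> 0).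
Proof.
by apply: isOP_hermite => //; [exact: mom_gweight1|exact: mom_gweightSS].
Qed.

Let cvg_Mz k : Mz t k @[t --> +oo] --> G k.
Proof. exact: (cvg_mom_weight1 N d). Qed.

Lemma cvg_mulT_F1 t : (T - t) * F1 T @[T --> +oo] --> (0 : R).
Proof.
(* [S T] equals $T F_N'(T)$ for $T \ge 1$, written in $z$, where the Jacobi entries converge. *)
pose S T := - 2^-1 + N%:R^-1 * \sum_(i < N) jacobi2_diag (Mz T) (Pz T) (bz T) i.
have cS : S T @[T --> +oo] --> (0 : R).
  have e : - 2^-1 + N%:R^-1 * \sum_(i < N) jacobi2_diag G (hermite a) (fun=> 0) i = 0.
    (* The Hermite entries are $(2i+1)a$, with sum $N^2a = N/2$. *)
    have -> : \sum_(i < N) jacobi2_diag G (hermite a) (fun=> 0) i = N%:R ^+ 2 * a.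
      elim: (N) => [|n IHn]; first by rewrite big_ord0 expr0n/= mul0r.
      rewrite big_ord_recr /= IHn /jacobi2_diag !gamma2_hermite//; last 4 first.
      - exact: mom_gweight1.
      - exact: mom_gweightSS.
      - exact: mom_gweight1.
      - exact: mom_gweightSS.
      by rewrite -[n.+1%:R]natr1; ring.
    by rewrite /a; field; rewrite gt_eqF.
  rewrite -[X in _ --> X]e; apply: cvgD; first exact: cvg_cst.
  apply: cvgM; first exact: cvg_cst.
  apply: (cvg_sumn (pinfty_nbhs R) N (fun i t => jacobi2_diag (Mz t) (Pz t) (bz t) i)
    (jacobi2_diag G (hermite a) (fun=> 0))) => i.
  exact: (cvg_jacobi2_diag (pinfty_nbhs R) _ _ _ _ _ _ opz opG cvg_Mz i).
have cI : (T : R)^-1 @[T --> +oo] --> (0 : R).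
  by apply/gtr0_cvgV0; [exact: nbhs_pinfty_gt|exact: cvg_id].
have : (1 - t * T^-1) * S T @[T --> +oo] --> (0 : R).
  rewrite -[X in _ --> X](mulr0 (1 - t * 0)); apply: cvgM => //.
  by apply: cvgB; [exact: cvg_cst|apply: cvgM; [exact: cvg_cst|exact: cI]].
apply: cvg_trans; apply: near_eq_cvg; near=> T.
have T1 : 1 <= T by near: T; exact: nbhs_pinfty_ge.
rewrite /S /F1; under eq_bigr do rewrite jacobi2_diag_u.
rewrite -mulr_sumr mE//; field.
by rewrite (gt_eqF NR0) gt_eqF//; lra.
Unshelve. all: by end_near. Qed.

Lemma FGaussE :
  FGauss R N = - N%:R ^- 2 * ln (N`!%:R * \prod_(i < N) sqnorm G (hermite a) i).
Proof.
congr (_ * ln _); rewrite (eq_bigr (fun i : 'I_N => i`!%:R * a ^+ i * G 0%N)).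
  (* With $s = \sqrt{2N}$, $a = s^{-2}$ and [G 0] is $\sqrt{2\pi}/s$, so all exponents are integers.
     Keeping [s] fixed, the induction concerns the number of factors only and uses $(n+1)^2 = n^2 +
     2n + 1$. *)
  rewrite /a; set s : R := Num.sqrt (2 * N%:R).
  have s0 : s != 0 by rewrite gt_eqF// sqrtr_gt0 mulr_gt0.
  have -> : 2 * N%:R = s ^+ 2 by rewrite sqr_sqrtr// mulr_ge0// ltW.
  have -> : G 0%N = Num.sqrt (2 * pi) / s.
    rewrite /G mom_gweight0// /s -sqrtrV ?mulr_ge0 ?ler0n// -sqrtrM ?mulr_ge0 ?pi_ge0//.
    by congr Num.sqrt; field; rewrite gt_eqF.
  elim: (N) => [|n IHn]; first by rewrite big_geq// !big_ord0 !expr0 fact0 divr1 !mulr1.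
  rewrite big_nat_recr//= big_ord_recr /=; set p := \prod_(i < n) _ in IHn *.
  transitivity (n.+1%:R * (n`!%:R * p) *
    (n`!%:R * s ^- 2 ^+ n * (Num.sqrt (2 * pi) / s))); last first.
    by rewrite factS natrM; ring.
  rewrite -IHn factS natrM.
  have -> : s ^+ (n.+1 ^ 2) = s ^+ (n ^ 2) * (s ^+ n) ^+ 2 * s.
    by rewrite -exprM -exprD -exprSr; congr (_ ^+ _); rewrite -[n.+1]addn1 sqrnD;
      rewrite exp1n muln1 addnAC addn1 mulnC.
  have -> : s ^- 2 ^+ n = (s ^+ n) ^- 2 by rewrite exprVn -!exprM mulnC.
  by rewrite exprS; field; rewrite s0 !expf_neq0.
by move=> i _; rewrite sqnorm_hermite//; [exact: mom_gweight1|exact: mom_gweightSS].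
Qed.

Lemma cvg_FN : F0 T @[T --> +oo] --> FGauss R N.
Proof.
rewrite FGaussE; apply: (@cvg_trans _ (- N%:R ^- 2 *
    ln (N`!%:R * \prod_(i < N) sqnorm (Mz T) (Pz T) i) @[T --> +oo])).
  apply: near_eq_cvg; near=> T.
  have T1 : 1 <= T by near: T; exact: nbhs_pinfty_ge.
  by rewrite -FN_F0 ?FN_sqnorm.
apply: cvgM; first exact: cvg_cst.
apply: continuous_cvg.
  apply: continuous_ln; rewrite mulr_gt0 ?ltr0n ?fact_gt0// prodr_gt0// => i _.
  exact: isOP_hgt0 opG i.
apply: cvgM; first exact: cvg_cst.
elim: (N) => [|n IHn].
  by rewrite big_ord0; under eq_fun do rewrite big_ord0; exact: cvg_cst.
rewrite big_ord_recr; under eq_fun do rewrite big_ord_recr/=.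
apply: cvgM IHn _; exact: (cvg_sqnorm (pinfty_nbhs R) _ _ _ _ _ _ opz opG cvg_Mz n).
Unshelve. all: by end_near. Qed.

Lemma cvg_Rintegral_integrand t : 1 <= t ->
  Rintegral mu `[t, T] (integrand N V P beta t) @[T --> +oo] -->
    FN N V t - FGauss R N.
Proof.
move=> t1; have : (T - t) * F1 T - F0 T + F0 t @[T --> +oo] -->
    0 - FGauss R N + F0 t.
  apply: cvgD; last exact: cvg_cst.
  by apply: cvgB; [exact: cvg_mulT_F1|exact: cvg_FN].
rewrite sub0r addrC -FN_F0//; apply: cvg_trans; apply: near_eq_cvg.
near=> T; rewrite Rintegral_integrand ?FN_F0//.
by near: T; exact: (nbhs_pinfty_gt (num_real t)).
Unshelve. all: by end_near. Qed.

End FreeEnergy.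

(** The improper integral is rendered as a limit of integrals over [[t, T]]; the integrability
    clause ensures that these are genuine integrals and not default values of [Rintegral]. *)
Theorem theorem3p4 (R : realType) (d N : nat) (V : {poly R})
    (P : R -> nat -> {poly R}) (beta : R -> nat -> R) (t : R) :
  (0 < d)%N -> (0 < N)%N ->
  V`_0 = 0 -> size V = (2 * d).+1 -> 0 < lead_coef V ->
  (forall tau, 1 <= tau -> monic_OP (weight N V tau) (P tau)) ->
  (forall tau, 1 <= tau ->
     recurrence_beta (weight N V tau) (P tau) (beta tau)) ->
  1 <= t ->
  (forall T, t <= T ->
     (@lebesgue_measure R).-integrable `[t, T]
        (fun tau => (integrand N V P beta t tau)%:E)) /\
  (Rintegral (@lebesgue_measure R) `[t, T] (integrand N V P beta t))
     @[T --> +oo] --> FN N V t - FGauss R N.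
Proof.
move=> d0 N0 V0 sV lV monP recP t1; split=> [T _|].
  exact: (integrable_integrand d).
exact: (cvg_Rintegral_integrand d).
Qed.
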